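(* Let $M={}_{f_2}M_1\times_{f_1}M_2$ with metric $g$ be a doubly warped product manifold whose second factor manifold $M_2$ is compact. If the function $l=\ln f_2$ (pulled back to $M$) is harmonic with respect to the Laplacian $\Delta$ of $(M,g)$, i.e. $\Delta l=0$ on $M$, then $M$ is a warped product manifold of the form $M_1\times_{f_1}M_2$.
   Context: Let $(M_1,g_1)$ and $(M_2,g_2)$ be Riemannian manifolds, let $f_1$ and $f_2$ be positive smooth functions on $M_1$ and $M_2$ respectively, and let $\pi_i:M_1\times M_2\to M_i$ be the canonical projections. The doubly warped product manifold ${}_{f_2}M_1\times_{f_1}M_2$ is $M_1\times M_2$ equipped with the metric $g=(f_2\circ\pi_2)^2\pi_1^*(g_1)+(f_1\circ\pi_1)^2\pi_2^*(g_2)$. Put $k=\ln f_1$ and $l=\ln f_2$; the same symbols denote the pullbacks $k\circ\pi_1$, $l\circ\pi_2$ to $M$. The Laplacian $\Delta$ is the trace with respect to $g$ of the Hessian of $(M,g)$. ''$M$ is a warped product manifold of the form $M_1\times_{f_1}M_2$'' means that $f_2$ is a constant $c_2$, so that $g=\tilde g_1\oplus f_1^2g_2$ with $\tilde g_1=c_2^2g_1$.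
   Formalization: The second factor M2 is assumed connected and M1 nonempty; without connectedness the claim fails (M2 two disjoint circles, f2 equal to 1 on one and 2 on the other, so l is harmonic but f2 is not constant). *)

(* Defs.v *)
From HB Require Import structures.
From mathcomp Require Import all_boot all_order all_algebra.
From mathcomp Require Import all_classical all_reals all_analysis.

Set Implicit Arguments.
Unset Strict Implicit.
Unset Printing Implicit Defensive.

Import Order.TTheory GRing.Theory Num.Theory.
Import numFieldNormedType.Exports.

Local Open Scope classical_set_scope.
Local Open Scope ring_scope.

Definition partial (R : realType) (n : nat) (i : 'I_n) (F : 'rV[R]_n -> R) :
  'rV[R]_n -> R := 'D_(delta_mx 0 i) F.

(* C^oo on U: the partial derivatives of every order exist and are
   differentiable (in the Frechet sense) at every point of U. *)
Definition smooth_on (R : realType) (n : nat) (U : set 'rV[R]_n)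
    (F : 'rV[R]_n -> R) : Prop :=
  forall (s : seq 'I_n) (x : 'rV[R]_n), U x ->
    differentiable (foldr (@partial R n) F s) x.

Definition smooth_map_on (R : realType) (m n : nat) (U : set 'rV[R]_m)
    (F : 'rV[R]_m -> 'rV[R]_n) : Prop :=
  forall k : 'I_n, smooth_on U (fun x => F x 0 k).

(* [cmap] and [cinv] are total; only their restrictions to [cdom] and [ccod],
   which are mutually inverse homeomorphisms, are meaningful. *)
Record chart (R : realType) (M : topologicalType) (n : nat) := Chart {
  cdom : set M;
  ccod : set 'rV[R]_n;
  cmap : M -> 'rV[R]_n;
  cinv : 'rV[R]_n -> M;
  cdom_open : open cdom;
  ccod_open : open ccod;
  cmap_cod : forall p, cdom p -> ccod (cmap p);
  cinv_dom : forall x, ccod x -> cdom (cinv x);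
  cmapK : forall p, cdom p -> cinv (cmap p) = p;
  cinvK : forall x, ccod x -> cmap (cinv x) = x;
  cmap_continuous : forall p, cdom p -> {for p, continuous cmap};
  cinv_continuous : forall x, ccod x -> {for x, continuous cinv}
}.

Definition local_expr (R : realType) (M N : topologicalType) (m n : nat)
    (F : M -> N) (a : chart R M m) (b : chart R N n) : 'rV[R]_m -> 'rV[R]_n :=
  cmap b \o F \o cinv a.

Definition overlap (R : realType) (M : topologicalType) (n : nat)
    (a b : chart R M n) : set 'rV[R]_n :=
  [set x | ccod a x /\ cdom b (cinv a x)].

(* Neither connectedness nor nonemptiness is part of the definition. *)
Record manifold (R : realType) (n : nat) := Manifold {
  mspace :> topologicalType;
  mindex : Type;
  mchart : mindex -> chart R mspace n;
  mhausdorff : hausdorff_space mspace;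
  msecond_countable : @second_countable mspace;
  mcover : forall p, exists i, cdom (mchart i) p;
  mcompat : forall i j, smooth_map_on (overlap (mchart i) (mchart j))
                          (local_expr id (mchart i) (mchart j))
}.

Definition smooth_fun (R : realType) (n : nat) (M : manifold R n)
    (f : M -> R) : Prop :=
  forall i : mindex M, smooth_on (ccod (mchart i)) (f \o cinv (mchart i)).

(* A covariant 2-tensor field, given by its matrix of components
   g(d_k, d_l) in each chart of the atlas, as a function of the coordinates. *)
Definition tensor2 (R : realType) (n : nat) (M : manifold R n) : Type :=
  mindex M -> 'rV[R]_n -> 'M[R]_n.

Definition tensor2_eq (R : realType) (n : nat) (M : manifold R n)
    (g h : tensor2 M) : Prop :=
  forall (i : mindex M) x, ccod (mchart i) x -> g i x = h i x.

(* Components in the chart [a] of F^*h, where [h] is given in the chart [b].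
   The Jacobian matrix of the library acts on row vectors from the right. *)
Definition pullback2 (R : realType) (M N : topologicalType) (m n : nat)
    (F : M -> N) (a : chart R M m) (b : chart R N n)
    (h : 'rV[R]_n -> 'M[R]_n) (x : 'rV[R]_m) : 'M[R]_m :=
  let J := jacobian (local_expr F a b) x in
  J *m h (local_expr F a b x) *m J^T.

Record riemannian_metric (R : realType) (n : nat) (M : manifold R n)
    (g : tensor2 M) : Prop := RiemannianMetric {
  metric_smooth : forall (i : mindex M) (k l : 'I_n),
    smooth_on (ccod (mchart i)) (fun x => g i x k l);
  metric_sym : forall (i : mindex M) x, ccod (mchart i) x -> (g i x)^T = g i x;
  metric_posdef : forall (i : mindex M) x (v : 'rV[R]_n),
    ccod (mchart i) x -> v != 0 -> 0 < (v *m g i x *m v^T) 0 0;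
  metric_compat : forall (i j : mindex M) x,
    overlap (mchart i) (mchart j) x ->
    g i x = pullback2 id (mchart i) (mchart j) (g j) x
}.

(* Christoffel symbol Gamma^k_ij of the components [g] of a metric. *)
Definition christoffel (R : realType) (n : nat) (g : 'rV[R]_n -> 'M[R]_n)
    (k i j : 'I_n) (x : 'rV[R]_n) : R :=
  2^-1 * \sum_(l < n) invmx (g x) k l *
    (partial i (fun y => g y j l) x + partial j (fun y => g y i l) x
     - partial l (fun y => g y i j) x).

Definition hessian (R : realType) (n : nat) (g : 'rV[R]_n -> 'M[R]_n)
    (F : 'rV[R]_n -> R) (x : 'rV[R]_n) : 'M[R]_n :=
  \matrix_(i < n, j < n) (partial i (partial j F) x
    - \sum_(k < n) christoffel g k i j x * partial k F x).

(* The trace of the Hessian with respect to g, read in the chart [i]: the value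
   at [x] is that of the function Delta f at the point [cinv (mchart i) x].  The
   Hessian being a tensor, this value does not depend on the chart. *)
Definition laplacian (R : realType) (n : nat) (M : manifold R n)
    (g : tensor2 M) (f : M -> R) (i : mindex M) (x : 'rV[R]_n) : R :=
  \tr (invmx (g i x) *m hessian (g i) (f \o cinv (mchart i)) x).

Definition harmonic_fun (R : realType) (n : nat) (M : manifold R n)
    (g : tensor2 M) (f : M -> R) : Prop :=
  forall (i : mindex M) x, ccod (mchart i) x -> laplacian g f i x = 0.

Section Smooth.
Context {R : realType}.

Lemma near_eq_is_diff (V W : normedModType R) (f g : V -> W) (x : V) :
  (\near x, f x = g x) -> differentiable f x -> is_diff x g ('d f x).
Proof.
move=> fg df.
have fgx : f x = g x := nbhs_singleton fg.
have dg : g \o shift x = cst (g x) + 'd f x +o_ 0 id.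
  apply/eqaddoP => e e0; rewrite -fgx.
  have /eqaddoP/(_ e e0) := diff_locally df.
  have := fg; rewrite (near_shift 0) subr0 => fg0.
  by apply: filterS2 fg0 => h; rewrite !fctE /= => ->.
have dc := diff_continuous df.
have dE : 'd g x = 'd f x :> (V -> W) by exact: diff_unique.
by apply: DiffDef => //; apply/diff_locallyP; rewrite dE.
Qed.

Lemma near_eq_differentiable (V W : normedModType R) (f g : V -> W) (x : V) :
  (\near x, f x = g x) -> differentiable f x -> differentiable g x.
Proof. by move=> fg /(near_eq_is_diff fg) []. Qed.

Lemma smooth_on_cst (n : nat) (U : set 'rV[R]_n) (c : R) : smooth_on U (cst c).
Proof.
move=> s x _; suff [d ->] : exists d, foldr (@partial R n) (cst c) s = cst d.
  exact: differentiable_cst.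
elim: s => [|i s [d /= ->]]; first by exists c.
by exists 0; apply/funext => y; rewrite /partial derive_cst.
Qed.

Section OnOpen.
Context (n : nat) (U : set 'rV[R]_n) (oU : open U).
Implicit Types f g : 'rV[R]_n -> R.

Lemma eq_on_near (T : Type) (f g : 'rV[R]_n -> T) x :
  {in U, f =1 g} -> U x -> \near x, f x = g x.
Proof.
move=> fg Ux; have : nbhs x U by apply: open_nbhs_nbhs.
by apply: filterS => y Uy; apply: fg; rewrite inE.
Qed.

Lemma partial_eq_on f g i :
  {in U, f =1 g} -> {in U, partial i f =1 partial i g}.
Proof.
by move=> fg x; rewrite inE => Ux; apply/near_eq_derive/eq_on_near.
Qed.

Lemma smooth_on_ind (P : ('rV[R]_n -> R) -> Prop) :
  (forall f, P f -> forall x, U x -> differentiable f x) ->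
  (forall f, P f -> forall i, exists2 h, P h & {in U, partial i f =1 h}) ->
  forall f, P f -> smooth_on U f.
Proof.
move=> Pd Pp f Pf s x Ux.
have [h Ph fh] : exists2 h, P h & {in U, foldr (@partial R n) f s =1 h}.
  elim: s => [|i s [h Ph fh]]; first by exists f.
  have [k Pk hk] := Pp h Ph i; exists k => // y Uy.
  by rewrite /= (partial_eq_on i fh Uy) hk.
by apply: near_eq_differentiable (Pd h Ph x Ux);
   apply: eq_on_near => // y Uy; rewrite fh.
Qed.

Lemma smooth_on_differentiable f x : smooth_on U f -> U x -> differentiable f x.
Proof. by move=> /(_ [::] x). Qed.

Lemma smooth_on_partial f i : smooth_on U f -> smooth_on U (partial i f).
Proof. by move=> sf s; have := sf (rcons s i); rewrite foldr_rcons. Qed.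

Lemma smooth_on_eq f g : {in U, f =1 g} -> smooth_on U f -> smooth_on U g.
Proof.
move=> fg sf.
apply: (smooth_on_ind (P := fun g => exists2 f, smooth_on U f & {in U, f =1 g})).
- move=> {fg}{}g [{sf}{}f sf fg] x Ux.
  apply: near_eq_differentiable (smooth_on_differentiable sf Ux).
  exact: eq_on_near.
- move=> {fg}{}g [{sf}{}f sf fg] i; exists (partial i f).
    by exists (partial i f) => //; exact: smooth_on_partial.
  by move=> x Ux; rewrite (partial_eq_on i fg Ux).
- by exists f.
Qed.

Inductive smooth_alg : ('rV[R]_n -> R) -> Prop :=
| Alg_smooth f : smooth_on U f -> smooth_alg f
| Alg_add f g : smooth_alg f -> smooth_alg g -> smooth_alg (f + g)
| Alg_mul f g : smooth_alg f -> smooth_alg g -> smooth_alg (f * g).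

Lemma smooth_alg_on f : smooth_alg f -> smooth_on U f.
Proof.
move: f; have ad f : smooth_alg f -> forall x, U x -> differentiable f x.
  elim=> {f} [f sf|f g _ df _ dg|f g _ df _ dg] x Ux.
  - exact: smooth_on_differentiable.
  - by apply: differentiableD; [exact: df | exact: dg].
  - by apply: differentiableM; [exact: df | exact: dg].
apply: smooth_on_ind => // f; elim=> {f}.
- by move=> f sf i; exists (partial i f) => //; apply/Alg_smooth/smooth_on_partial.
- move=> f g af IHf ag IHg i.
  have [h ah fh] := IHf i; have [k ak gk] := IHg i.
  exists (h + k); first exact: Alg_add.
  move=> x Ux; rewrite [RHS]/(h x + k x) -fh// -gk//; rewrite inE in Ux.
  by rewrite /partial deriveD//; apply: diff_derivable; exact: ad.
- move=> f g af IHf ag IHg i.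
  have [h ah fh] := IHf i; have [k ak gk] := IHg i.
  exists (f * k + g * h); first by apply: Alg_add; apply: Alg_mul.
  move=> x Ux; rewrite [RHS]/(f x * k x + g x * h x) -fh// -gk//.
  rewrite inE in Ux; by rewrite /partial deriveM//; apply: diff_derivable; exact: ad.
Qed.

Lemma smooth_onD f g :
  smooth_on U f -> smooth_on U g -> smooth_on U (fun x => f x + g x).
Proof.
by move=> sf sg; apply: smooth_alg_on; apply: (@Alg_add f g); exact: Alg_smooth.
Qed.

Lemma smooth_onM f g :
  smooth_on U f -> smooth_on U g -> smooth_on U (fun x => f x * g x).
Proof.
by move=> sf sg; apply: smooth_alg_on; apply: (@Alg_mul f g); exact: Alg_smooth.
Qed.

Lemma smooth_on_sum (I : Type) (r : seq I) (f : I -> 'rV[R]_n -> R) :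
  (forall k, smooth_on U (f k)) -> smooth_on U (fun x => \sum_(k <- r) f k x).
Proof.
move=> sf; elim: r => [|k r IH].
  by apply: smooth_on_eq (@smooth_on_cst n U 0) => x _; rewrite big_nil.
by apply: smooth_on_eq (smooth_onD (sf k) IH) => x _; rewrite big_cons.
Qed.

End OnOpen.

Lemma smooth_map_differentiable (m n : nat) (U : set 'rV[R]_m)
    (F : 'rV[R]_m -> 'rV[R]_n) x :
  smooth_map_on U F -> U x -> differentiable F x.
Proof.
move=> sF Ux.
have -> : F = \sum_(k < n) (fun y => F y 0 k *: delta_mx 0 k).
  by apply/funext => y; rewrite fct_sumE [LHS]row_sum_delta.
apply: differentiable_sum => k.
apply: (@differentiableZl _ _ _ (fun y => F y 0 k)).
exact: (sF k [::] x Ux).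
Qed.

Section Proj.
Context (n1 n2 : nat).

Lemma partial_lsubmx (f : 'rV[R]_n1 -> R) (i : 'I_(n1 + n2)) :
  partial i (f \o lsubmx) = match fintype.split i with
    inl i1 => partial i1 f \o lsubmx | inr _ => cst 0 end.
Proof.
apply/funext => x; case: (split_ordP i) => j ->; rewrite /partial /derive /=.
- apply: (congr1 (fun F : R -> R => lim (F @ 0^'))); apply/funext => h /=.
  congr (_ *: (f _ - _)); apply/rowP => k.
  by rewrite !mxE /= (inj_eq (@lshift_inj _ _)).
- rewrite (_ : (fun _ => _) = cst 0); first exact: lim_cst.
  apply/funext => h /=; rewrite (_ : lsubmx (_ + _) = lsubmx x).
    by rewrite subrr scaler0.
  by apply/rowP => k; rewrite !mxE /= eq_lrshift mulr0 add0r.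
Qed.

Lemma partial_rsubmx (f : 'rV[R]_n2 -> R) (i : 'I_(n1 + n2)) :
  partial i (f \o rsubmx) = match fintype.split i with
    inl _ => cst 0 | inr i2 => partial i2 f \o rsubmx end.
Proof.
apply/funext => x; case: (split_ordP i) => j ->; rewrite /partial /derive /=.
- rewrite (_ : (fun _ => _) = cst 0); first exact: lim_cst.
  apply/funext => h /=; rewrite (_ : rsubmx (_ + _) = rsubmx x).
    by rewrite subrr scaler0.
  by apply/rowP => k; rewrite !mxE /= eq_rlshift mulr0 add0r.
- apply: (congr1 (fun F : R -> R => lim (F @ 0^'))); apply/funext => h /=.
  congr (_ *: (f _ - _)); apply/rowP => k.
  by rewrite !mxE /= (inj_eq (@rshift_inj _ _)).
Qed.

Lemma smooth_on_lsubmx (U : set 'rV[R]_n1) (V : set 'rV[R]_(n1 + n2)) f :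
  V `<=` lsubmx @^-1` U -> smooth_on U f -> smooth_on V (f \o lsubmx).
Proof.
move=> VU sf s x Vx.
suff [h sh ->] : exists2 h, smooth_on U h &
    foldr (@partial R _) (f \o lsubmx) s = h \o lsubmx.
  apply: differentiable_comp; first exact: differentiable_lsubmx.
  by apply: (sh [::]); exact: VU.
elim: s => [|i s [h sh /= ->]]; first by exists f.
rewrite partial_lsubmx; case: fintype.split => j.
- by exists (partial j h) => //; exact: smooth_on_partial.
- by exists (cst 0) => //; exact: smooth_on_cst.
Qed.

Lemma smooth_on_rsubmx (U : set 'rV[R]_n2) (V : set 'rV[R]_(n1 + n2)) f :
  V `<=` rsubmx @^-1` U -> smooth_on U f -> smooth_on V (f \o rsubmx).
Proof.
move=> VU sf s x Vx.
suff [h sh ->] : exists2 h, smooth_on U h &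
    foldr (@partial R _) (f \o rsubmx) s = h \o rsubmx.
  apply: differentiable_comp; first exact: differentiable_rsubmx.
  by apply: (sh [::]); exact: VU.
elim: s => [|i s [h sh /= ->]]; first by exists f.
rewrite partial_rsubmx; case: fintype.split => j.
- by exists (cst 0) => //; exact: smooth_on_cst.
- by exists (partial j h) => //; exact: smooth_on_partial.
Qed.

End Proj.

End Smooth.

Section ProdChart.
Context {R : realType} {M1 M2 : topologicalType} {n1 n2 : nat}.
Context (a : chart R M1 n1) (b : chart R M2 n2).

Let pdom : set (M1 * M2) := cdom a `*` cdom b.
Let pcod : set 'rV[R]_(n1 + n2) :=
  [set x | ccod a (lsubmx x) /\ ccod b (rsubmx x)].
Let pmap (p : M1 * M2) : 'rV[R]_(n1 + n2) := row_mx (cmap a p.1) (cmap b p.2).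
Let pinv (x : 'rV[R]_(n1 + n2)) : M1 * M2 :=
  (cinv a (lsubmx x), cinv b (rsubmx x)).

Lemma prod_cdom_open : open pdom.
Proof.
rewrite openE => -[p q] [/= ap bq]; exists (cdom a, cdom b) => //=.
by split; apply: open_nbhs_nbhs; split=> //; exact: cdom_open.
Qed.

Lemma prod_ccod_open : open pcod.
Proof.
have -> : pcod = lsubmx @^-1` ccod a `&` rsubmx @^-1` ccod b by [].
apply: openI.
- apply: open_comp; last exact: ccod_open.
  by move=> x _; exact: continuous_lsubmx.
- apply: open_comp; last exact: ccod_open.
  by move=> x _; exact: continuous_rsubmx.
Qed.

Lemma prod_cmap_cod p : pdom p -> pcod (pmap p).
Proof.
by move=> [ap bp]; rewrite /pcod /pmap /= row_mxKl row_mxKr; split;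
  exact: cmap_cod.
Qed.

Lemma prod_cinv_dom x : pcod x -> pdom (pinv x).
Proof. by move=> [ax bx]; split; exact: cinv_dom. Qed.

Lemma prod_cmapK p : pdom p -> pinv (pmap p) = p.
Proof.
by case: p => p q [ap bp]; rewrite /pinv /pmap row_mxKl row_mxKr !cmapK.
Qed.

Lemma prod_cinvK x : pcod x -> pmap (pinv x) = x.
Proof. by move=> [ax bx]; rewrite /pmap /pinv /= !cinvK// hsubmxK. Qed.

Lemma prod_cmap_continuous p : pdom p -> {for p, continuous pmap}.
Proof.
move=> [ap bp] A [P PA sA].
have Pl j : \forall q \near p.1, P 0 (lshift n2 j) (cmap a q 0 j).
  have := cvg_comp _ _ (cmap_continuous ap) (@coord_continuous R 1 n1 0 j _).
  apply.
  by have := PA 0 (lshift n2 j); rewrite /pmap row_mxEl.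
have Pr j : \forall q \near p.2, P 0 (rshift n1 j) (cmap b q 0 j).
  have := cvg_comp _ _ (cmap_continuous bp) (@coord_continuous R 1 n2 0 j _).
  apply.
  by have := PA 0 (rshift n1 j); rewrite /pmap row_mxEr.
exists ([set q | forall j, P 0 (lshift n2 j) (cmap a q 0 j)],
        [set q | forall j, P 0 (rshift n1 j) (cmap b q 0 j)]).
  by split; apply: filter_forall.
move=> q [/= ql qr]; apply: sA => i j; rewrite ord1.
by case: (split_ordP j) => k ->; rewrite /pmap ?row_mxEl ?row_mxEr.
Qed.

Lemma prod_cinv_continuous x : pcod x -> {for x, continuous pinv}.
Proof.
move=> [ax bx].
have cl : cinv a (lsubmx y) @[y --> x] --> cinv a (lsubmx x).
  exact: cvg_comp (@continuous_lsubmx R 1 n1 n2 x) (cinv_continuous ax).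
have cr : cinv b (rsubmx y) @[y --> x] --> cinv b (rsubmx x).
  exact: cvg_comp (@continuous_rsubmx R 1 n1 n2 x) (cinv_continuous bx).
exact: cvg_pair cl cr.
Qed.

Definition prod_chart : chart R (M1 * M2)%type (n1 + n2) :=
  Chart prod_cdom_open prod_ccod_open prod_cmap_cod prod_cinv_dom
    prod_cmapK prod_cinvK prod_cmap_continuous prod_cinv_continuous.

End ProdChart.

Lemma prod_hausdorff (M1 M2 : topologicalType) :
  hausdorff_space M1 -> hausdorff_space M2 ->
  hausdorff_space (M1 * M2)%type.
Proof.
move=> h1 h2 [p1 p2] [q1 q2] pq; congr (_, _).
- apply: h1 => A B pA qB.
  have [||[x y] [[Ax Ay] [Bx By]]] := pq (A `*` setT) (B `*` setT).
  + by exists (A, setT) => //; split=> //; exact: filterT.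
  + by exists (B, setT) => //; split=> //; exact: filterT.
  + by exists x.
- apply: h2 => A B pA qB.
  have [||[x y] [[Ax Ay] [Bx By]]] := pq (setT `*` A) (setT `*` B).
  + by exists (setT, A) => //; split=> //; exact: filterT.
  + by exists (setT, B) => //; split=> //; exact: filterT.
  + by exists y.
Qed.

Lemma prod_second_countable (M1 M2 : topologicalType) :
  @second_countable M1 -> @second_countable M2 ->
  @second_countable (M1 * M2)%type.
Proof.
move=> [B1 cB1 [oB1 bB1]] [B2 cB2 [oB2 bB2]].
exists [set U `*` V | U in B1 & V in B2].
  rewrite (_ : image2 _ _ _ = (fun UV => UV.1 `*` UV.2) @` (B1 `*` B2)).
    by apply: card_le_trans (card_image_le _ _) _; exact: countableX.
  apply/seteqP; split=> [_ [U BU [V BV <-]]|_ [[U V] [/= BU BV] <-]].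
    by exists (U, V).
  by exists U => //; exists V.
split=> [_ [U BU [V BV <-]]|[p q] A [[P Q] [/= pP qQ] PQA]].
  rewrite openE => -[p q] [/= Up Vq]; exists (U, V) => //=.
  by split; apply: open_nbhs_nbhs; split=> //; [exact: oB1|exact: oB2].
have [U [BU Up] UP] := bB1 p P pP; have [V [BV Vq] VQ] := bB2 q Q qQ.
exists (U `*` V).
  by split=> //; exists U => //; exists V.
by move=> [x y] [/= Ux Vy]; apply: PQA; split; [exact: UP|exact: VQ].
Qed.

Section ProdManifold.
Context {R : realType} {n1 n2 : nat} (M1 : manifold R n1) (M2 : manifold R n2).

Let pchart (i : mindex M1 * mindex M2) := prod_chart (mchart i.1) (mchart i.2).

Lemma prod_mcover p : exists i, cdom (pchart i) p.
Proof.
by have [i ip] := mcover p.1; have [j jp] := mcover p.2; exists (i, j).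
Qed.

Lemma lsubmx_local_expr i j x :
  lsubmx (local_expr id (pchart i) (pchart j) x) =
  local_expr id (mchart i.1) (mchart j.1) (lsubmx x).
Proof. by rewrite /local_expr /= row_mxKl. Qed.

Lemma rsubmx_local_expr i j x :
  rsubmx (local_expr id (pchart i) (pchart j) x) =
  local_expr id (mchart i.2) (mchart j.2) (rsubmx x).
Proof. by rewrite /local_expr /= row_mxKr. Qed.

Lemma prod_overlap i j x : overlap (pchart i) (pchart j) x ->
  overlap (mchart i.1) (mchart j.1) (lsubmx x) /\
  overlap (mchart i.2) (mchart j.2) (rsubmx x).
Proof. by move=> [[? ?] [? ?]]. Qed.

Lemma prod_mcompat i j :
  smooth_map_on (overlap (pchart i) (pchart j))
    (local_expr id (pchart i) (pchart j)).
Proof.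
move=> k; case: (split_ordP k) => l ->.
- rewrite (_ : (fun x => _) =
    (fun x => local_expr id (mchart i.1) (mchart j.1) x 0 l) \o lsubmx).
    by apply: (smooth_on_lsubmx _ (@mcompat _ _ M1 i.1 j.1 l)) => x /prod_overlap[].
  by apply/funext => x; rewrite [RHS]/= -lsubmx_local_expr [RHS]mxE.
- rewrite (_ : (fun x => _) =
    (fun x => local_expr id (mchart i.2) (mchart j.2) x 0 l) \o rsubmx).
    by apply: (smooth_on_rsubmx _ (@mcompat _ _ M2 i.2 j.2 l)) => x /prod_overlap[].
  by apply/funext => x; rewrite [RHS]/= -rsubmx_local_expr [RHS]mxE.
Qed.

Definition prod_manifold : manifold R (n1 + n2) :=
  Manifold (prod_hausdorff (@mhausdorff _ _ M1) (@mhausdorff _ _ M2))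
    (prod_second_countable (@msecond_countable _ _ M1)
       (@msecond_countable _ _ M2))
    prod_mcover prod_mcompat.

(* pi_1^* h and pi_2^* h; the chart of the factor is the matching factor of
   the product chart. *)
Definition pullback_fst (h : tensor2 M1) : tensor2 prod_manifold :=
  fun i => pullback2 fst (@mchart _ _ prod_manifold i) (mchart i.1) (h i.1).

Definition pullback_snd (h : tensor2 M2) : tensor2 prod_manifold :=
  fun i => pullback2 snd (@mchart _ _ prod_manifold i) (mchart i.2) (h i.2).

Definition doubly_warped_metric (g1 : tensor2 M1) (g2 : tensor2 M2)
    (f1 : M1 -> R) (f2 : M2 -> R) : tensor2 prod_manifold :=
  fun i x => let p := cinv (@mchart _ _ prod_manifold i) x in
    f2 p.2 ^+ 2 *: pullback_fst g1 i x + f1 p.1 ^+ 2 *: pullback_snd g2 i x.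

(* g1 (+) f1^2 g2 *)
Definition warped_metric (g1 : tensor2 M1) (g2 : tensor2 M2) (f1 : M1 -> R) :
    tensor2 prod_manifold :=
  fun i x => let p := cinv (@mchart _ _ prod_manifold i) x in
    pullback_fst g1 i x + f1 p.1 ^+ 2 *: pullback_snd g2 i x.

Definition is_warped_product (g1 : tensor2 M1) (g2 : tensor2 M2)
    (f1 : M1 -> R) (f2 : M2 -> R) : Prop :=
  exists c2 : R, [/\ 0 < c2, (forall y, f2 y = c2) &
    tensor2_eq (doubly_warped_metric g1 g2 f1 f2)
      (warped_metric (fun i x => c2 ^+ 2 *: g1 i x) g2 f1)].

End ProdManifold.

Section DoublyWarped.
Context {R : realType} {n1 n2 : nat} (M1 : manifold R n1) (M2 : manifold R n2).
Local Notation M := (prod_manifold M1 M2).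
Let P1 : 'M[R]_(n1 + n2, n1) := lin1_mx lsubmx.
Let P2 : 'M[R]_(n1 + n2, n2) := lin1_mx rsubmx.

Lemma smooth_fun_fst (f : M1 -> R) :
  smooth_fun f -> smooth_fun (f \o fst : M -> R).
Proof.
by move=> sf i; apply: (smooth_on_lsubmx (n2 := n2) _ (sf i.1)) => x [].
Qed.

Lemma smooth_fun_snd (f : M2 -> R) :
  smooth_fun f -> smooth_fun (f \o snd : M -> R).
Proof.
by move=> sf i; apply: (smooth_on_rsubmx (n1 := n1) _ (sf i.2)) => x [].
Qed.

Lemma mul_P1 (v : 'rV[R]_(n1 + n2)) : v *m P1 = lsubmx v.
Proof. exact: mul_rV_lin1. Qed.

Lemma mul_P2 (v : 'rV[R]_(n1 + n2)) : v *m P2 = rsubmx v.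
Proof. exact: mul_rV_lin1. Qed.

Lemma jacobian_lsubmx (x : 'rV[R]_(n1 + n2)) : jacobian lsubmx x = P1.
Proof.
by rewrite /jacobian; congr lin1_mx; apply: diff_lin; exact: continuous_lsubmx.
Qed.

Lemma jacobian_rsubmx (x : 'rV[R]_(n1 + n2)) : jacobian rsubmx x = P2.
Proof.
by rewrite /jacobian; congr lin1_mx; apply: diff_lin; exact: continuous_rsubmx.
Qed.

Lemma jacobian_near m n (F G : 'rV[R]_m -> 'rV[R]_n) x :
  (\near x, F x = G x) -> differentiable F x -> jacobian G x = jacobian F x.
Proof.
move=> FG dF; have dE : 'd G x = 'd F x :> ('rV[R]_m -> 'rV[R]_n).
  by have [_] := near_eq_is_diff FG dF.
exact: (congr1 (@lin1_mx R m n) dE).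
Qed.

Lemma jacobian_comp m n p (F : 'rV[R]_m -> 'rV[R]_n) (G : 'rV[R]_n -> 'rV[R]_p)
    x : differentiable F x -> differentiable G (F x) ->
  jacobian (G \o F) x = jacobian F x *m jacobian G (F x).
Proof.
move=> dF dG; apply/row_matrixP => k; rewrite row_mul rowE mul_rV_lin1.
by rewrite diff_comp//= rowE !mul_rV_lin1.
Qed.

Lemma pullback_fstE (g : tensor2 M1) (i : mindex M) x : ccod (mchart i) x ->
  pullback_fst g i x = P1 *m g i.1 (lsubmx x) *m P1^T.
Proof.
move=> ix; have E y : ccod (mchart i) y ->
    lsubmx y = local_expr fst (mchart i) (mchart i.1) y.
  by move=> [iy _]; rewrite /local_expr /= cinvK.
have J : jacobian (local_expr fst (mchart i) (mchart i.1)) x = P1.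
  rewrite -(jacobian_lsubmx x); apply: jacobian_near.
    apply: (eq_on_near (@ccod_open _ _ _ (mchart i)) _ ix) => y.
    by rewrite inE; exact: E.
  exact: differentiable_lsubmx.
by rewrite /pullback_fst /pullback2 J -E.
Qed.

Lemma pullback_sndE (g : tensor2 M2) (i : mindex M) x : ccod (mchart i) x ->
  pullback_snd g i x = P2 *m g i.2 (rsubmx x) *m P2^T.
Proof.
move=> ix; have E y : ccod (mchart i) y ->
    rsubmx y = local_expr snd (mchart i) (mchart i.2) y.
  by move=> [_ iy]; rewrite /local_expr /= cinvK.
have J : jacobian (local_expr snd (mchart i) (mchart i.2)) x = P2.
  rewrite -(jacobian_rsubmx x); apply: jacobian_near.
    apply: (eq_on_near (@ccod_open _ _ _ (mchart i)) _ ix) => y.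
    by rewrite inE; exact: E.
  exact: differentiable_rsubmx.
by rewrite /pullback_snd /pullback2 J -E.
Qed.

Lemma smooth_on_congr m n (U : set 'rV[R]_m) (P : 'M[R]_(m, n))
    (G : 'rV[R]_m -> 'M[R]_n) (oU : open U) k l :
  (forall a b, smooth_on U (fun x => G x a b)) ->
  smooth_on U (fun x => (P *m G x *m P^T) k l).
Proof.
move=> sG.
have : smooth_on U
    (fun x => \sum_b (\sum_a P k a * G x a b) * P^T b l).
  apply: smooth_on_sum => // b; apply: smooth_onM => //; last first.
    exact: smooth_on_cst.
  apply: smooth_on_sum => // a; apply: smooth_onM => //.
  exact: smooth_on_cst.
apply: smooth_on_eq => // x _; rewrite [RHS]mxE.
by apply: eq_bigr => b _; rewrite !mxE.
Qed.

Lemma doubly_warped_riemannian (g1 : tensor2 M1) (g2 : tensor2 M2)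
    (f1 : M1 -> R) (f2 : M2 -> R) :
  riemannian_metric g1 -> riemannian_metric g2 ->
  smooth_fun f1 -> smooth_fun f2 ->
  (forall p, 0 < f1 p) -> (forall q, 0 < f2 q) ->
  riemannian_metric (doubly_warped_metric g1 g2 f1 f2).
Proof.
move=> m1 m2 s1 s2 p1 p2.
have E i x : ccod (mchart i) x -> doubly_warped_metric g1 g2 f1 f2 i x =
    f2 (cinv (mchart i.2) (rsubmx x)) ^+ 2
      *: (P1 *m g1 i.1 (lsubmx x) *m P1^T) +
    f1 (cinv (mchart i.1) (lsubmx x)) ^+ 2
      *: (P2 *m g2 i.2 (rsubmx x) *m P2^T).
  by move=> ix; rewrite /doubly_warped_metric pullback_fstE// pullback_sndE.
split.
- move=> i k l; have oi := @ccod_open _ _ _ (mchart i).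
  have S : smooth_on (ccod (mchart i)) (fun x =>
      (f2 (cinv (mchart i.2) (rsubmx x)) * f2 (cinv (mchart i.2) (rsubmx x)))
        * (P1 *m g1 i.1 (lsubmx x) *m P1^T) k l +
      (f1 (cinv (mchart i.1) (lsubmx x)) * f1 (cinv (mchart i.1) (lsubmx x)))
        * (P2 *m g2 i.2 (rsubmx x) *m P2^T) k l).
    apply: smooth_onD => //; apply: smooth_onM => //; try apply: smooth_onM => //.
    + exact: (smooth_fun_snd s2).
    + exact: (smooth_fun_snd s2).
    + apply: smooth_on_congr => // a b.
      by apply: (smooth_on_lsubmx _ (metric_smooth m1 (i := i.1) a b)) => x [].
    + exact: (smooth_fun_fst s1).
    + exact: (smooth_fun_fst s1).
    + apply: smooth_on_congr => // a b.
      by apply: (smooth_on_rsubmx _ (metric_smooth m2 (i := i.2) a b)) => x [].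
  by apply: smooth_on_eq S => // x; rewrite inE => ix; rewrite E// !mxE !expr2.
- move=> i x ix; have [i1 i2] := ix; rewrite E// linearD /= !linearZ /=.
  by rewrite !trmx_mul !trmxK (metric_sym m1 i1) (metric_sym m2 i2) !mulmxA.
- move=> i x v ix v0; have [i1 i2] := ix.
  have -> : (v *m doubly_warped_metric g1 g2 f1 f2 i x *m v^T) 0 0 =
    f2 (cinv (mchart i.2) (rsubmx x)) ^+ 2 *
      (lsubmx v *m g1 i.1 (lsubmx x) *m (lsubmx v)^T) 0 0 +
    f1 (cinv (mchart i.1) (lsubmx x)) ^+ 2 *
      (rsubmx v *m g2 i.2 (rsubmx x) *m (rsubmx v)^T) 0 0.
    rewrite E// mulmxDr mulmxDl -!scalemxAr -!scalemxAl -!mul_P1 -!mul_P2.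
    by rewrite !trmx_mul !mulmxA !mxE.
  have q1 : 0 < f1 (cinv (mchart i.1) (lsubmx x)) ^+ 2 by rewrite exprn_gt0.
  have q2 : 0 < f2 (cinv (mchart i.2) (rsubmx x)) ^+ 2 by rewrite exprn_gt0.
  have ge0 n (N : manifold R n) (g : tensor2 N) : riemannian_metric g ->
      forall j y (w : 'rV[R]_n), ccod (mchart j) y -> 0 <= (w *m g j y *m w^T) 0 0.
    move=> mg j y w jy; have [->|w0] := eqVneq w 0; last first.
      by apply: ltW; exact: (metric_posdef mg).
    by rewrite !mul0mx mxE.
  have [l0|l0] := eqVneq (lsubmx v) 0.
    apply: ltr_wpDl; first by apply: mulr_ge0; [exact: ltW | exact: (ge0 _ _ _ m1)].
    rewrite mulr_gt0//; apply: (metric_posdef m2) => //.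
    by apply: contraNneq v0 => r0; rewrite -(hsubmxK v) l0 r0 row_mx0.
  apply: ltr_wpDr; first by apply: mulr_ge0; [exact: ltW | exact: (ge0 _ _ _ m2)].
  by rewrite mulr_gt0//; exact: (metric_posdef m1).
- move=> i j x ijx; have [ix jx] := ijx.
  have [u1 u2] := prod_overlap ijx.
  set T := local_expr id (mchart i) (mchart j).
  have dT : differentiable T x 
    by exact: (smooth_map_differentiable (@mcompat _ _ M i j) ijx).
  have d1 := smooth_map_differentiable (@mcompat _ _ M1 i.1 j.1) u1.
  have d2 := smooth_map_differentiable (@mcompat _ _ M2 i.2 j.2) u2.
  have J1 : jacobian T x *m P1 =
      P1 *m jacobian (local_expr id (mchart i.1) (mchart j.1)) (lsubmx x).
    have C : lsubmx \o T =
        local_expr id (mchart i.1) (mchart j.1) \o lsubmx.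
      by apply/funext => y; exact: lsubmx_local_expr.
    have := congr1 (fun F => jacobian F x) C.
    rewrite (jacobian_comp dT (differentiable_lsubmx _)).
    rewrite (jacobian_comp (differentiable_lsubmx _) d1).
    by rewrite (jacobian_lsubmx (T x)) (jacobian_lsubmx x).
  have J2 : jacobian T x *m P2 =
      P2 *m jacobian (local_expr id (mchart i.2) (mchart j.2)) (rsubmx x).
    have C : rsubmx \o T =
        local_expr id (mchart i.2) (mchart j.2) \o rsubmx.
      by apply/funext => y; exact: rsubmx_local_expr.
    have := congr1 (fun F => jacobian F x) C.
    rewrite (jacobian_comp dT (differentiable_rsubmx _)).
    rewrite (jacobian_comp (differentiable_rsubmx _) d2).
    by rewrite (jacobian_rsubmx (T x)) (jacobian_rsubmx x).
  have jTx : ccod (mchart j) (T x) by exact: cmap_cod.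
  rewrite /pullback2 -/T E// (E j)// mulmxDr mulmxDl -!scalemxAr -!scalemxAl.
  rewrite (metric_compat m1 u1) (metric_compat m2 u2) /pullback2.
  rewrite !mulmxA -J1 -J2 -!mulmxA -!trmx_mul.
  rewrite -J1 -J2 !lsubmx_local_expr !rsubmx_local_expr.
  have c1 : cinv (mchart j.1) (local_expr id (mchart i.1) (mchart j.1) (lsubmx x))
     = cinv (mchart i.1) (lsubmx x) by rewrite /local_expr /= cmapK//; case: u1.
  have c2 : cinv (mchart j.2) (local_expr id (mchart i.2) (mchart j.2) (rsubmx x))
     = cinv (mchart i.2) (rsubmx x) by rewrite /local_expr /= cmapK//; case: u2.
  by rewrite c1 c2 !mulmxA.
Qed.

End DoublyWarped.

(* Main.v *)
Require Import Defs.
From HB Require Import structures.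
From mathcomp Require Import all_boot all_order all_algebra.
From mathcomp Require Import all_classical all_reals all_analysis.
From mathcomp Require Import ring lra.

Set Implicit Arguments.
Unset Strict Implicit.
Unset Printing Implicit Defensive.

Import Order.TTheory GRing.Theory Num.Theory.
Import numFieldNormedType.Exports.

Local Open Scope classical_set_scope.
Local Open Scope ring_scope.

(** The theorem is an instance of the strong maximum principle.  The function
    l depends on the second factor only, so above a fixed point p of M_1 the
    equation Delta l = 0 becomes an equation on M_2: in a chart,
      tr (A H) + b . grad l = 0,
    where H is the matrix of second partial derivatives of l with respect to
    the coordinates of M_2, A is the lower right block of the inverse of the
    metric matrix, and b collects the Christoffel symbols
    ([laplacian_slice]).  A principal block of the inverse of a positive
    definite matrix is positive definite, and A and b are continuous
    ([slice_coefficients]): the equation is elliptic without zeroth order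
    term.

    By the strong maximum principle ([strong_maximum_principle]) a solution of
    such an equation that reaches its maximum at a point is constant near that
    point.  So the set where f_2 is maximal is open ([harmonic_log_max_open]);
    it is closed because f_2 is continuous, and nonempty because M_2 is
    compact.  As M_2 is connected, f_2 is constant, and the constant moves
    into the metric of the first factor ([doubly_warped_metric_cst]).

    The strong maximum principle is proved after E. Hopf.  Let L u >= 0 and
    u <= m.  If the set where u = m is not a neighbourhood of one of its
    points, a nearby point y with u(y) < m has a closest point z in that set,
    and then u < m in a ball that has z on its boundary.  There is a barrier w
    with w(z) = 0 and L w > 0 near z that, near z, is positive only inside a
    smaller ball touching the boundary at z.  For small t > 0 the function
    u + t w then has an interior local maximum near z
    ([no_interior_touching]), where L (u + t w) <= 0 by the second derivative
    test ([elliptic_op_le0_at_max]), although L u >= 0 and L w > 0. *)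

(** * Positive definite matrices *)

Definition posdef {R : numDomainType} {n : nat} (A : 'M[R]_n) : Prop :=
  A^T = A /\ forall v : 'rV_n, v != 0 -> 0 < (v *m A *m v^T) 0 0.

Lemma posdef_unitmx {R : numFieldType} {n : nat} (A : 'M[R]_n) :
  posdef A -> A \in unitmx.
Proof.
move=> [_ pA]; rewrite -row_free_unit; apply/row_freeP; apply: contrapT => nA.
have /rowV0Pn [v /sub_kermxP vA v0] : kermx A != 0.
  apply: contra_notN nA => /eqP k0.
  by apply/row_freeP; rewrite -kermx_eq0 k0.
by have := pA v v0; rewrite vA mul0mx mxE ltxx.
Qed.

Lemma posdef_invmx {R : numFieldType} {n : nat} (A : 'M[R]_n) :
  posdef A -> posdef (invmx A).
Proof.
move=> pA; have uA := posdef_unitmx pA; have [sA qA] := pA.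
have sI : (invmx A)^T = invmx A by rewrite trmx_inv sA.
split=> // v v0.
have := qA (v *m invmx A); rewrite trmx_mul sI !mulmxA mulmxKV//; apply.
by apply: contraNneq v0 => vI; rewrite -(mulmxKV uA v) vI mul0mx.
Qed.

Lemma posdef_drsubmx {R : numDomainType} {m n : nat} (A : 'M[R]_(m + n)) :
  posdef A -> posdef (drsubmx A).
Proof.
move=> [sA pA]; split=> [|v v0]; first by rewrite trmx_drsub sA.
have := pA (row_mx 0 v); rewrite -{1}(submxK A) tr_row_mx mul_row_block.
rewrite mul_row_col !mul0mx trmx0 mulmx0 !add0r; apply.
by apply: contraNneq v0 => /(congr1 rsubmx); rewrite row_mxKr linear0 => ->.
Qed.

(** Cholesky factorization: split off the first row and column and apply the
    induction hypothesis to the Schur complement of the corner entry. *)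
Lemma posdef_gram {R : rcfType} {n : nat} (A : 'M[R]_n) :
  posdef A -> exists B : 'M[R]_n, A = B *m B^T.
Proof.
elim: n A => [|n IHn] A pA; first by exists 0; apply/matrixP => -[].
suff : forall A : 'M[R]_(1 + n), posdef A -> exists B : 'M[R]_(1 + n), A = B *m B^T.
  exact.
move=> {pA}{}A [sA pA].
set b := ursubmx A; set a := A 0 0.
have aE : ulsubmx A = a%:M by rewrite [LHS]mx11_scalar !mxE !lshift0.
have bE : dlsubmx A = b^T by rewrite /b trmx_ursub sA.
have a0 : 0 < a.
  have := pA (row_mx 1%:M 0).
  rewrite -{1}(submxK A) tr_row_mx mul_row_block mul_row_col !mul0mx.
  rewrite trmx0 mulmx0 trmx1 mulmx1 mul1mx !addr0 aE mxE eqxx mulr1n; apply.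
  apply/eqP => /(congr1 lsubmx); rewrite row_mxKl linear0 => /matrixP/(_ 0 0).
  by rewrite !mxE eqxx; apply/eqP; exact: oner_neq0.
have an0 := lt0r_neq0 a0.
have [|B BE] := IHn (drsubmx A - a^-1 *: (b^T *m b)).
  split=> [|v v0]; first by rewrite linearB linearZ /= trmx_mul trmxK trmx_drsub sA.
  (* The first coordinate is the one that minimizes the quadratic form, so that
     its value is the quadratic form of the Schur complement at v. *)
  have := pA (row_mx (- a^-1 *: (v *m b^T)) v).
  rewrite -{1}(submxK A) tr_row_mx mul_row_block mul_row_col aE bE -/b.
  rewrite mul_mx_scalar scalerA mulrN mulfV// scaleN1r addNr mul0mx add0r.
  rewrite -scalemxAl mulmxBr mulmxBl -scalemxAr -scalemxAl scaleNr.
  rewrite !mulmxA mulmxDl -scalemxAl scaleNr.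
  rewrite [in X in _ -> 0 < X]addrC; apply.
  by apply: contraNneq v0 => /(congr1 rsubmx); rewrite row_mxKr linear0 => ->.
have sa : Num.sqrt a * Num.sqrt a = a by rewrite -expr2 sqr_sqrtr ?ltW.
have sn0 : Num.sqrt a != 0 by rewrite gt_eqF// sqrtr_gt0.
exists (block_mx (Num.sqrt a)%:M 0 ((Num.sqrt a)^-1 *: b^T) B).
rewrite tr_block_mx mulmx_block trmx0 tr_scalar_mx linearZ /= trmxK.
rewrite !mul0mx !mulmx0 !addr0 -scalar_mxM sa mul_scalar_mx scalerA mulfV//.
rewrite mul_mx_scalar scalerA mulfV// !scale1r -scalemxAl -scalemxAr scalerA.
by rewrite -invfM sa -BE addrC subrK -aE -bE submxK.
Qed.

(** With A = B B^T, the trace is the sum of the values of the quadratic form of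
    H at the columns of B. *)
Lemma posdef_mxtrace_le0 {R : rcfType} {n : nat} (A H : 'M[R]_n) :
  posdef A -> (forall v : 'rV_n, (v *m H *m v^T) 0 0 <= 0) ->
  \tr (A *m H) <= 0.
Proof.
move=> /posdef_gram[B ->] nH; rewrite -mulmxA mxtrace_mulC.
rewrite /mxtrace; apply: sumr_le0 => k _.
have := nH (row k B^T).
by rewrite tr_row trmxK -row_mul colE mulmxA -row_mul -mulmxA -colE !mxE.
Qed.

(** * The second derivative test *)

Section SecondDerivativeTest.
Context {R : realType}.

(** If g'(0) were positive then g > 0 just to the right of 0, and f would
    increase there by the mean value theorem. *)
Lemma second_derive1_le0 (f g : R -> R) (e : R) : 0 < e ->
  (forall t : R, `|t| < e -> is_derive t 1 f (g t)) ->
  (forall t : R, `|t| < e -> f t <= f 0) -> derivable g (0 : R) 1 ->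
  g 0 = 0 /\ 'D_1 g 0 <= 0.
Proof.
move=> e0 df fmax dg.
have itvE t : (t \in `]-e, e[) = (`|t| < e) by rewrite in_itv/= -ltr_norml.
have g00 : g 0 = 0.
  have d0 : is_derive (0 : R) 1 f (g 0) by apply: df; rewrite normr0.
  rewrite -[LHS](@derive_val _ _ _ _ _ _ _ d0).
  suff d00 : is_derive (0 : R) 1 f 0 by rewrite derive_val.
  apply: (@derive1_at_max _ f (- e) e); first lra.
  - by move=> t; rewrite itvE => /df [].
  - by rewrite itvE normr0.
  - by move=> t; rewrite itvE; exact: fmax.
split => //; rewrite leNgt; apply/negP => D0.
have : \forall h \near 0^', 0 < h^-1 *: ((g \o shift 0) (h *: 1) - g 0).
  exact: (@cvgr_gt _ _ _ _ _ ('D_1 g 0) dg).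
move=> /nbhs_ballP[d /= d0 dP].
have gpos t : 0 < t -> t < d -> 0 < g t.
  move=> t0 td; have := dP t; rewrite /ball/= sub0r normrN gtr0_norm// => /(_ td).
  rewrite g00 subr0 addr0 [t *: 1]mulr1 => /(_ (lt0r_neq0 t0)).
  by rewrite [_ *: _]/(_ * _) pmulr_rgt0// invr_gt0.
pose t := Num.min d e / 2.
have m0 : 0 < Num.min d e by rewrite lt_min d0 e0.
have t0 : 0 < t by rewrite divr_gt0.
have tm : t < Num.min d e by rewrite /t ltr_pdivrMr// mulr_natr mulr2n ltrDl.
have /andP[td te] : (t < d) && (t < e) by rewrite -lt_min.
have dft s : s \in `[0, t] -> is_derive (s : R) 1 f (g s).
  rewrite in_itv/= => /andP[s0 st]; apply: df.
  by rewrite ger0_norm// (le_lt_trans st).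
have fc : {within `[0, t], continuous f}.
  by apply: derivable_within_continuous => s sI; have [] := dft s sI.
have dfo s : s \in `]0, t[ -> is_derive (s : R) 1 f (g s).
  by move=> sI; apply: dft; exact: subset_itv_oo_cc sI.
have [s sI fE] := MVT t0 dfo fc.
move: sI; rewrite in_itv/= => /andP[s0 st].
have : f t <= f 0 by apply: fmax; rewrite gtr0_norm.
rewrite -subr_le0 fE subr0 leNgt mulr_gt0// gpos//.
exact: lt_trans td.
Qed.

Lemma is_derive_line (V W : normedModType R) (f : V -> W) (x v : V) (t : R) :
  derivable f (t *: v + x) v ->
  is_derive t 1 (fun s : R => f (s *: v + x)) ('D_v f (t *: v + x)).
Proof.
move=> df.
have E : (fun h : R => h^-1 *: (((fun s => f (s *: v + x)) \o shift t) (h *: 1)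
      - f (t *: v + x))) =
    (fun h : R => h^-1 *: ((f \o shift (t *: v + x)) (h *: v) - f (t *: v + x))).
  by apply/funext => h /=; rewrite [h *: 1]mulr1 scalerDl addrA.
by apply: DeriveDef; rewrite /derivable /derive E.
Qed.

Lemma second_derivative_test (V : normedModType R) (f : V -> R) (x v : V) :
  (\forall y \near x, derivable f y v) -> (\forall y \near x, f y <= f x) ->
  derivable ('D_v f) x v -> 'D_v f x = 0 /\ 'D_v ('D_v f) x <= 0.
Proof.
move=> df fmax ddf.
have lx : (fun s : R => s *: v + x) @ 0 --> x.
  rewrite -[in X in _ --> X](add0r x) -[in X in _ --> X](scale0r v).
  apply: cvgD; last exact: cvg_cst.
  by apply: cvgZr_tmp; exact: cvg_id.
have [e /= e0 eP] : \forall s \near (0 : R),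
    derivable f (s *: v + x) v /\ f (s *: v + x) <= f x.
  exact: (lx _ (filterI df fmax)).
have eP' s : `|s| < e -> derivable f (s *: v + x) v /\ f (s *: v + x) <= f x.
  by move=> se; apply: eP; rewrite /= sub0r normrN.
have l0 : 0 *: v + x = x by rewrite scale0r add0r.
have dx : is_derive (0 : R) 1 (fun s : R => 'D_v f (s *: v + x)) ('D_v ('D_v f) x).
  by rewrite -[in X in is_derive _ _ _ X]l0; apply: is_derive_line; rewrite l0.
have [] := @second_derive1_le0 (fun s => f (s *: v + x))
  (fun s => 'D_v f (s *: v + x)) e e0.
- by move=> t /eP'[dt _]; exact: is_derive_line.
- by move=> t /eP'[_ ?]; rewrite l0.
- by have [] := dx.
- by rewrite derive_val l0.
Qed.

Lemma derive_partial n (f : 'rV[R]_n -> R) (x v : 'rV[R]_n) :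
  differentiable f x -> 'D_v f x = \sum_(k < n) v 0 k * partial k f x.
Proof.
move=> df; rewrite deriveE// {1}(row_sum_delta v) linear_sum.
by apply: eq_bigr => k _; rewrite linearZ /= -deriveE.
Qed.

(** The inner directional derivative is a fixed linear combination of the partial
    derivatives near x, so the outer one can be taken term by term. *)
Lemma derive2_partial n (f : 'rV[R]_n -> R) (x v : 'rV[R]_n) :
  (\forall y \near x, differentiable f y) ->
  (forall k, differentiable (partial k f) x) ->
  differentiable ('D_v f) x /\ 'D_v ('D_v f) x =
    (v *m (\matrix_(i, j) partial i (partial j f) x) *m v^T) 0 0.
Proof.
move=> df ddf.
have fE : \forall y \near x, (\sum_(k < n) (v 0 k \*: partial k f)) y = 'D_v f y.
  near=> y; rewrite derive_partial; last by near: y.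
  by rewrite fct_sumE; apply: eq_bigr => k _.
have ds : differentiable (\sum_(k < n) (v 0 k \*: partial k f)) x.
  by apply: differentiable_sum => k; exact: differentiableZ.
split; first exact: near_eq_differentiable ds.
rewrite -(near_eq_derive _ fE) derive_sum; last first.
  by move=> k; apply: derivableZ; exact: diff_derivable.
rewrite !mxE; apply: eq_bigr => j _; rewrite !mxE mulr_suml.
rewrite deriveZ; last exact: diff_derivable.
rewrite derive_partial// [LHS]mulr_sumr; apply: eq_bigr => i _.
by rewrite !mxE mulrC.
Unshelve. all: by end_near. Qed.

End SecondDerivativeTest.

(** * Elliptic operators and the barrier *)

Section EllipticOperator.
Context {R : realType} {n : nat}.
Implicit Types (A : 'rV[R]_n -> 'M[R]_n) (b : 'rV[R]_n -> 'rV[R]_n).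
Implicit Types (u v : 'rV[R]_n -> R) (x : 'rV[R]_n).

(** The Hessian of the flat connection in the coordinates; the Christoffel terms
    of a Riemannian Hessian are absorbed in the first order part below. *)
Definition coord_hessian u x : 'M[R]_n :=
  \matrix_(i, j) partial i (partial j u) x.

Definition elliptic_op A b u x : R :=
  \tr (A x *m coord_hessian u x) + \sum_k b x 0 k * partial k u x.

Definition twice_differentiable u x : Prop :=
  (\forall y \near x, differentiable u y) /\
  forall k, differentiable (partial k u) x.

(** The gradient vanishes, which removes the first order part, and the quadratic
    form of the Hessian is nonpositive, which settles the second order part. *)
Lemma elliptic_op_le0_at_max A b u x : posdef (A x) ->
  twice_differentiable u x -> (\forall y \near x, u y <= u x) ->
  elliptic_op A b u x <= 0.
Proof.
move=> pA [du ddu] umax.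
have test (h : 'rV[R]_n) : 'D_h u x = 0 /\ 'D_h ('D_h u) x <= 0.
  apply: second_derivative_test => //; last first.
    by have [/diff_derivable] := derive2_partial h du ddu.
  by apply: filterS du => y /diff_derivable.
rewrite /elliptic_op big1 ?addr0 => [|k _].
  apply: posdef_mxtrace_le0 => // h.
  by have [_ <-] := derive2_partial h du ddu; have [] := test h.
by rewrite /partial; have [-> _] := test (delta_mx 0 k); rewrite mulr0.
Qed.

Lemma elliptic_opD A b u v x (e : R) :
  twice_differentiable u x -> twice_differentiable v x ->
  twice_differentiable (u + e *: v) x /\
  elliptic_op A b (u + e *: v) x = elliptic_op A b u x + e * elliptic_op A b v x.
Proof.
move=> [du ddu] [dv ddv].
have pE k : \forall y \near x,
    (partial k u + e *: partial k v) y = partial k (u + e *: v) y.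
  near=> y; rewrite /partial deriveD ?deriveZ//.
  - by apply: diff_derivable; near: y.
  - by apply: diff_derivable; near: y.
  - by apply/derivableZ/diff_derivable; near: y.
have dd k : differentiable (partial k u + e *: partial k v) x.
  by apply: differentiableD => //; exact: differentiableZ.
split.
  split; last by move=> k; exact: near_eq_differentiable (dd k).
  near=> y; apply: differentiableD; first by near: y.
  by apply: differentiableZ; near: y.
rewrite /elliptic_op.
have -> : coord_hessian (u + e *: v) x = coord_hessian u x + e *: coord_hessian v x.
  apply/matrixP => i j; rewrite !mxE -[LHS](near_eq_derive _ (pE j)).
  by rewrite deriveD ?deriveZ//; [| |apply: derivableZ]; exact: diff_derivable.
rewrite mulmxDr -scalemxAr linearD linearZ /= mulrDr.
rewrite [RHS]addrACA; congr (_ + _).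
rewrite mulr_sumr -big_split/=; apply: eq_bigr => k _.
by rewrite -(nbhs_singleton (pE k)) mulrDr mulrCA.
Unshelve. all: by end_near. Qed.

End EllipticOperator.

Section Barrier.
Context {R : realType} {n : nat} (z c : 'rV[R]_n) (a : R).

(** This is |x - (z - c/2)|^2 - |c/2|^2: it is nonpositive exactly on the closed
    ball centred at z - c/2 whose sphere goes through z. *)
Definition tangent_gap (x : 'rV[R]_n) : R :=
  \sum_k ((x 0 k - z 0 k) ^+ 2 + (x 0 k - z 0 k) * c 0 k).

(** A polynomial substitute for the classical exponential barrier: near z it has
    the sign of - tangent_gap, and for large a its quadratic term makes it a
    strict subsolution at z. *)
Definition barrier (x : 'rV[R]_n) : R :=
  - tangent_gap x + a / 2 * tangent_gap x ^+ 2.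

Definition gap_grad k (x : 'rV[R]_n) : R := 2 * (x 0 k - z 0 k) + c 0 k.

Lemma is_derive_coord k (x v : 'rV[R]_n) :
  is_derive x v (fun y : 'rV[R]_n => y 0 k) (v 0 k).
Proof.
apply: DeriveDef; first exact/diff_derivable/differentiable_coord.
apply: lim_near_cst => //; near=> h => /=.
rewrite !mxE addrK [_ *: _]mulKf//.
by near: h; exact: nbhs_dnbhs_neq.
Unshelve. all: by end_near. Qed.

Lemma differentiable_tangent_gap x : differentiable tangent_gap x.
Proof.
rewrite (_ : tangent_gap = \sum_k (fun x : 'rV[R]_n =>
    (x 0 k - z 0 k) ^+ 2 + (x 0 k - z 0 k) * c 0 k)); last first.
  by apply/funext => y; rewrite fct_sumE.
apply: differentiable_sum => k.
have d : differentiable ((fun y : 'rV[R]_n => y 0 k) - cst (z 0 k)) x.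
  by apply: differentiableB => //; exact: differentiable_coord.
apply: (@differentiableD _ _ _
  (((fun y : 'rV[R]_n => y 0 k) - cst (z 0 k)) ^+ 2)
  (((fun y : 'rV[R]_n => y 0 k) - cst (z 0 k)) * cst (c 0 k))).
- exact: differentiableX.
- exact: differentiableM.
Qed.

Lemma partial_tangent_gap k : partial k tangent_gap = gap_grad k.
Proof.
apply/funext => x; rewrite /partial.
rewrite (_ : tangent_gap = \sum_k (
  ((fun y : 'rV[R]_n => y 0 k) - cst (z 0 k)) ^+ 2 +
  ((fun y : 'rV[R]_n => y 0 k) - cst (z 0 k)) * cst (c 0 k))); last first.
  by apply/funext => y; rewrite fct_sumE.
have D i := @is_derive_coord i x (delta_mx 0 k).
rewrite derive_val (bigD1 k)//= big1 => [|i ik]; last first.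
  by rewrite !mxE (negbTE ik) !(subr0, scaler0, addr0).
rewrite addr0 !mxE !eqxx/= /gap_grad /cst /GRing.scale/= subr0 expr1 !mulr1 mulr0.
by rewrite add0r.
Qed.

Lemma differentiable_gap_grad k x : differentiable (gap_grad k) x.
Proof.
apply: (@differentiableD _ _ _
  (2 *: ((fun y : 'rV[R]_n => y 0 k) - cst (z 0 k))) (cst (c 0 k))) => //.
apply: differentiableZ; apply: differentiableB => //.
exact: differentiable_coord.
Qed.

Lemma partial_gap_grad i k : partial i (gap_grad k) = cst (2 *+ (k == i)).
Proof.
apply/funext => x; rewrite /partial.
rewrite (_ : gap_grad k = 2 *: ((fun y : 'rV[R]_n => y 0 k) - cst (z 0 k))
  + cst (c 0 k)) //.
have D := @is_derive_coord k x (delta_mx 0 i).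
by rewrite derive_val !mxE /= subr0 addr0 /GRing.scale/= eq_sym mulr_natr.
Qed.

Lemma partial_barrier k :
  partial k barrier = (a *: tangent_gap - cst 1) * gap_grad k.
Proof.
apply/funext => x; rewrite /partial.
rewrite (_ : barrier = - tangent_gap + (a / 2) *: tangent_gap ^+ 2) //.
have D : is_derive x (delta_mx 0 k) tangent_gap (gap_grad k x).
  rewrite -partial_tangent_gap; apply/derivableP/diff_derivable.
  exact: differentiable_tangent_gap.
rewrite derive_val /GRing.scale/= expr1.
by transitivity ((a * tangent_gap x - 1) * gap_grad k x) => //; field.
Qed.

Lemma twice_differentiable_barrier x : twice_differentiable barrier x.
Proof.
split=> [|k].
  apply: filterE => y; apply: (@differentiableD _ _ _ (- tangent_gap)
    ((a / 2) *: tangent_gap ^+ 2)).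
    exact/differentiableN/differentiable_tangent_gap.
  exact/differentiableZ/differentiableX/differentiable_tangent_gap.
rewrite partial_barrier; apply: differentiableM.
  apply: differentiableB => //.
  exact/differentiableZ/differentiable_tangent_gap.
exact: differentiable_gap_grad.
Qed.

Lemma coord_hessian_barrier x : coord_hessian barrier x =
  a *: ((\row_k gap_grad k x)^T *m (\row_k gap_grad k x)) +
  (2 * (a * tangent_gap x - 1))%:M.
Proof.
apply/matrixP => i j; rewrite !mxE big_ord1 !mxE partial_barrier /partial.
have D : is_derive x (delta_mx 0 i) tangent_gap (gap_grad i x).
  rewrite -partial_tangent_gap; apply/derivableP/diff_derivable.
  exact: differentiable_tangent_gap.
have D' : is_derive x (delta_mx 0 i) (gap_grad j) (2 *+ (j == i)).
  rewrite -[2 *+ _]/(cst (2 *+ (j == i)) x) -partial_gap_grad.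
  exact/derivableP/diff_derivable/differentiable_gap_grad.
rewrite derive_val; transitivity ((a * tangent_gap x - 1) * (2 *+ (j == i)) +
  gap_grad j x * (a * gap_grad i x - 0)) => //; rewrite eq_sym.
by case: (i == j); rewrite ?mulr0n ?mulr1n; ring.
Qed.

Lemma tangent_gap_center : tangent_gap z = 0.
Proof.
by rewrite /tangent_gap big1// => k _; rewrite subrr expr0n mul0r addr0.
Qed.

Lemma barrier_center : barrier z = 0.
Proof. by rewrite /barrier tangent_gap_center expr0n mulr0 oppr0 addr0. Qed.

Lemma tangent_gap_le0 x :
  a * tangent_gap x < 2 -> 0 <= barrier x -> tangent_gap x <= 0.
Proof.
rewrite /barrier => at2 w0; rewrite leNgt; apply/negP => t0.
suff : - tangent_gap x + a / 2 * tangent_gap x ^+ 2 < 0 by rewrite ltNge w0.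
rewrite (_ : _ + _ = tangent_gap x * (a * tangent_gap x - 2) / 2); last by field.
by rewrite pmulr_llt0// pmulr_rlt0// subr_lt0.
Qed.

Lemma elliptic_op_barrier A b x : elliptic_op A b barrier x =
  a * ((\row_k gap_grad k x) *m A x *m (\row_k gap_grad k x)^T) 0 0 +
  2 * (a * tangent_gap x - 1) * \tr (A x) +
  \sum_k b x 0 k * ((a * tangent_gap x - 1) * gap_grad k x).
Proof.
rewrite /elliptic_op coord_hessian_barrier; congr (_ + _); last first.
  by apply: eq_bigr => k _; rewrite partial_barrier.
rewrite mulmxDr -scalemxAr mxtraceD mxtraceZ mul_mx_scalar mxtraceZ.
congr (_ * _ + _).
by rewrite mulmxA mxtrace_mulC mulmxA [LHS]big_ord1.
Qed.

End Barrier.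

(** * Continuity of scalar and matrix functions *)

Section ContinuousAt.
Context {R : realType} {T : topologicalType}.
Implicit Types (f g : T -> R) (x : T).

Lemma continuous_at_cst (k : R) x : continuous_at x (fun=> k).
Proof. exact: cvg_cst. Qed.

Lemma continuous_at_add f g x : continuous_at x f -> continuous_at x g ->
  continuous_at x (fun y => f y + g y).
Proof. exact: cvgD. Qed.

Lemma continuous_at_mul f g x : continuous_at x f -> continuous_at x g ->
  continuous_at x (fun y => f y * g y).
Proof. exact: cvgM. Qed.

Lemma continuous_at_opp f x : continuous_at x f ->
  continuous_at x (fun y => - f y).
Proof. exact: cvgN. Qed.

Lemma continuous_at_sum (I : Type) (r : seq I) (f : I -> T -> R) x :
  (forall i, continuous_at x (f i)) ->
  continuous_at x (fun y => \sum_(i <- r) f i y).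
Proof.
move=> cf; elim: r => [|i r IHr].
  by under eq_fun do rewrite big_nil; exact: continuous_at_cst.
by under eq_fun do rewrite big_cons; exact: continuous_at_add.
Qed.

Lemma continuous_at_prod (I : Type) (r : seq I) (f : I -> T -> R) x :
  (forall i, continuous_at x (f i)) ->
  continuous_at x (fun y => \prod_(i <- r) f i y).
Proof.
move=> cf; elim: r => [|i r IHr].
  by under eq_fun do rewrite big_nil; exact: continuous_at_cst.
by under eq_fun do rewrite big_cons; exact: continuous_at_mul.
Qed.

End ContinuousAt.

Section ContinuousMatrix.
Context {R : realType} {T : topologicalType}.
Implicit Types (x : T).

Definition mx_continuous_at {m n} x (A : T -> 'M[R]_(m, n)) : Prop :=
  forall i j, continuous_at x (fun y => A y i j).

Lemma continuous_at_mxtrace n (A : T -> 'M[R]_n) x :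
  mx_continuous_at x A -> continuous_at x (fun y => \tr (A y)).
Proof. by move=> cA; apply: continuous_at_sum => i; exact: cA. Qed.

Lemma mx_continuous_at_mul m n p (A : T -> 'M[R]_(m, n))
    (B : T -> 'M[R]_(n, p)) x :
  mx_continuous_at x A -> mx_continuous_at x B ->
  mx_continuous_at x (fun y => A y *m B y).
Proof.
move=> cA cB i j.
rewrite (_ : (fun y => _) = (fun y => \sum_k A y i k * B y k j)); last first.
  by apply/funext => y; rewrite mxE.
apply: continuous_at_sum => k; exact: continuous_at_mul.
Qed.

End ContinuousMatrix.

(** * The strong maximum principle *)

Section StrongMaximumPrinciple.
Context {R : realType} {n : nat}.
Implicit Types (A : 'rV[R]_n -> 'M[R]_n) (b : 'rV[R]_n -> 'rV[R]_n).
Implicit Types (u v : 'rV[R]_n -> R) (x y z c : 'rV[R]_n).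

Lemma continuous_at_elliptic_op_barrier A b z c a x :
  mx_continuous_at x A -> mx_continuous_at x b ->
  continuous_at x (elliptic_op A b (barrier z c a)).
Proof.
move=> cA cb.
have ct : continuous_at x (fun y => a * tangent_gap z c y - 1).
  apply: continuous_at_add; last exact: continuous_at_cst.
  apply: continuous_at_mul; first exact: continuous_at_cst.
  exact/differentiable_continuous/differentiable_tangent_gap.
have cg k : continuous_at x (gap_grad z c k).
  exact/differentiable_continuous/differentiable_gap_grad.
have cH : mx_continuous_at x (coord_hessian (barrier z c a)).
  move=> i j; rewrite (_ : (fun y => _) = (fun y =>
      a * (gap_grad z c i y * gap_grad z c j y) +
      (2 * (a * tangent_gap z c y - 1)) * (i == j)%:R)); last first.
    by apply/funext => y; rewrite coord_hessian_barrier !mxE big_ord1 !mxE mulr_natr.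
  apply: continuous_at_add.
    apply: continuous_at_mul; first exact: continuous_at_cst.
    exact: continuous_at_mul.
  apply: continuous_at_mul; last exact: continuous_at_cst.
  apply: continuous_at_mul => //; exact: continuous_at_cst.
apply: continuous_at_add.
  apply: continuous_at_mxtrace; exact: mx_continuous_at_mul.
apply: continuous_at_sum => k; apply: continuous_at_mul; first exact: cb.
by rewrite partial_barrier; exact: continuous_at_mul.
Qed.

(** At z the operator takes the value a (c A c^T) - s with s independent of a;
    a is chosen to make this 1, and continuity extends positivity to a
    neighbourhood. *)
Lemma barrier_strict_subsolution A b z c : posdef (A z) -> c != 0 ->
  mx_continuous_at z A -> mx_continuous_at z b ->
  exists a, \forall y \near z, 0 < elliptic_op A b (barrier z c a) y /\
    (0 <= barrier z c a y -> tangent_gap z c y <= 0).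
Proof.
move=> [_ pA] c0 cA cb; have q0 := pA c c0.
set q := (c *m A z *m c^T) 0 0 in q0.
pose s := 2 * \tr (A z) + \sum_k b z 0 k * c 0 k.
pose a := (s + 1) / q.
have Lz : elliptic_op A b (barrier z c a) z = 1.
  rewrite elliptic_op_barrier tangent_gap_center mulr0 sub0r.
  have gE k : gap_grad z c k z = c 0 k by rewrite /gap_grad subrr mulr0 add0r.
  have -> : \row_k gap_grad z c k z = c by apply/rowP => k; rewrite mxE gE.
  under eq_bigr do rewrite gE mulN1r mulrN.
  rewrite sumrN -/q /a divfK ?gt_eqF// /s; ring.
exists a.
have Lpos : \forall y \near z, 0 < elliptic_op A b (barrier z c a) y.
  have := @continuous_at_elliptic_op_barrier A b z c a z cA cb.
  by move/cvgr_gt; apply; rewrite Lz.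
have small : \forall y \near z, a * tangent_gap z c y < 2.
  have : continuous_at z (fun y => a * tangent_gap z c y).
    apply: continuous_at_mul; first exact: continuous_at_cst.
    exact/differentiable_continuous/differentiable_tangent_gap.
  by move/cvgr_lt; apply; rewrite tangent_gap_center mulr0.
apply: filterS2 Lpos small => y Ly ty; split => //.
exact: tangent_gap_le0.
Qed.

Lemma near_closed_ball (P : set 'rV[R]_n) z : (\forall x \near z, P x) ->
  exists2 d, 0 < d & forall x, `|x - z| <= d -> P x.
Proof.
move=> /nbhs_ballP[d /= d0 dP]; exists (d / 2); first by rewrite divr_gt0.
move=> x xz; apply: dP; rewrite -ball_normE /= distrC (le_lt_trans xz)//.
by rewrite ltr_pdivrMr// mulr_natr mulr2n ltrDl.
Qed.

Lemma closed_preimage_cst_le (f : 'rV[R]_n -> R) (m : R) :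
  continuous f -> closed [set x | f x <= m].
Proof.
move=> cf; apply: (@preimage_closed _ _ f [set y | y <= m]).
  by move=> x _; exact: cf.
exact: closed_le.
Qed.

Lemma continuous_dist z : continuous (fun x => `|x - z|).
Proof.
move=> x; have cB : {for x, continuous (fun y => y - z)}.
  by apply: continuousB; [exact: cvg_id | exact: cst_continuous].
exact: (cvg_norm cB).
Qed.

Lemma compact_closed_ball_norm z (d : R) : compact [set x | `|x - z| <= d].
Proof.
apply: bounded_closed_compact.
  exists (`|z| + d); split; first exact: num_real.
  move=> M Mz x /= xz; apply: ltW; apply: le_lt_trans Mz.
  by rewrite -(subrK z x) addrC (le_trans (ler_normD _ _))// lerD2l.
by apply: (@closed_preimage_cst_le (fun x => `|x - z|)); exact: continuous_dist.
Qed.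

(** Suppose u(z) = m.  On a small sphere around z, the barrier w is negative
    outside the touching ball, while u <= m - e on the compact part inside it.
    So for small t the function u + t w is less than m on the sphere but equal
    to m at z; its maximum is interior, where the operator is nonpositive, a
    contradiction. *)
Lemma no_interior_touching A b u z c (m : R) : c != 0 ->
  mx_continuous_at z A -> mx_continuous_at z b ->
  (\forall x \near z, [/\ posdef (A x), twice_differentiable u x,
     0 <= elliptic_op A b u x & u x <= m]) ->
  (\forall x \near z, x != z -> tangent_gap z c x <= 0 -> u x < m) ->
  u z < m.
Proof.
move=> c0 cA cb uP uT; have [pA _ _ uz] := nbhs_singleton uP.
rewrite lt_neqAle uz andbT; apply/negP => /eqP uzm.
have [a aP] := barrier_strict_subsolution pA c0 cA cb.
set w := barrier z c a in aP.
have [d d0 dP] := near_closed_ball (filterI uP (filterI aP uT)).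
pose K : set 'rV[R]_n := [set x | `|x - z| <= d].
have cK : compact K := @compact_closed_ball_norm z d.
have Kz : K z by rewrite /K/= subrr normr0 ltW.
have cu x : K x -> {for x, continuous u}.
  by move=> /dP[[_ [du _] _ _] _]; exact/differentiable_continuous/(nbhs_singleton du).
have cw : continuous w.
  move=> x; have [dw _] := twice_differentiable_barrier z c a x.
  exact/differentiable_continuous/(nbhs_singleton dw).
have [q _ wq] : exists2 q, q \in K & forall x, x \in K -> w x <= w q.
  by apply: EVT_max_rV; [exists z | | exact: continuous_subspaceT].
(* The part of the sphere inside the touching ball; inequalities are written as
   upper bounds on continuous functions. *)
pose S := K `&` ([set x | - `|x - z| <= - d] `&` [set x | tangent_gap z c x <= 0]).
have cS : compact S.
  apply: (subclosed_compact _ cK); last by move=> x [].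
  apply: closedI.
    by apply: (@closed_preimage_cst_le (fun x => `|x - z|)); exact: continuous_dist.
  apply: closedI.
    apply: (@closed_preimage_cst_le (fun x => - `|x - z|)) => x.
    by apply: continuous_at_opp; exact: continuous_dist.
  apply: closed_preimage_cst_le => x.
  exact/differentiable_continuous/differentiable_tangent_gap.
have [e e0 eS] : exists2 e, 0 < e & forall x, S x -> u x <= m - e.
  have [S0|/forallNP S0] := pselect (exists x, S x); last first.
    by exists 1 => // x Sx; have := S0 x.
  have [|s] := @EVT_max_rV _ _ u S S0 cS.
    by apply: continuous_in_subspaceT => x; rewrite inE => -[/cu].
  rewrite inE => -[Ks [/= sd st]] smax.
  exists (m - u s) => [|x Sx]; last by rewrite subKr smax// inE.
  rewrite subr_gt0; have [_ [_]] := dP s Ks; apply => //.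
  by apply: contraTneq sd => ->; rewrite subrr normr0 oppr0 oppr_ge0 -ltNge.
(* Small enough for t w < e on K. *)
pose t := e / 2 / (`|w q| + 1).
have W1 : 0 < `|w q| + 1 by rewrite ltr_pwDr.
have t0 : 0 < t by rewrite !divr_gt0.
have tw x : K x -> t * w x < e.
  move=> Kx; apply: (@le_lt_trans _ _ (t * (`|w q| + 1))).
    rewrite ler_pM2l// (le_trans (wq x _)) ?inE// (le_trans (ler_norm _))//.
    by rewrite lerDl.
  by rewrite /t divfK ?gt_eqF// ltr_pdivrMr// mulr_natr mulr2n ltrDl.
pose v := u + t *: w.
have vE x : v x = u x + t * w x by [].
have [p] : exists2 p, p \in K & forall x, x \in K -> v x <= v p.
  apply: EVT_max_rV; [by exists z | by [] |].
  apply: continuous_in_subspaceT => x; rewrite inE => Kx.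
  apply: continuous_at_add; first exact: cu.
  apply: continuous_at_mul; [exact: continuous_at_cst | exact: cw].
rewrite inE => Kp pmax.
have vp : m <= v p.
  have := pmax z; rewrite inE vE uzm [w z]barrier_center mulr0 addr0; exact.
have [[pAp uD Lu ump] [[Lw wT] _]] := dP p Kp.
have pd : `|p - z| < d.
  rewrite lt_neqAle Kp andbT; apply/negP => /eqP pd.
  have wp : 0 <= w p.
    rewrite -(pmulr_rge0 _ t0); have := vp; rewrite vE; lra.
  have Sp : S p by split => //; split; [rewrite /= pd | exact: wT].
  have := tw p Kp; have := eS p Sp; move: vp; rewrite vE; lra.
have vmax : \forall x \near p, v x <= v p.
  have : \forall x \near p, `|x - z| < d.
    by have /cvgr_lt := @continuous_dist z p; apply.
  by apply: filterS => x /ltW Kx; apply: pmax; rewrite inE.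
have [vD vL] := elliptic_opD A b t uD (twice_differentiable_barrier z c a p).
have := elliptic_op_le0_at_max b pAp vD vmax.
by rewrite vL leNgt ltr_wpDl// mulr_gt0.
Qed.

(** The norm on row vectors is the sup norm; touching balls need the Euclidean
    distance, whose square is smooth. *)
Definition sqdist x y : R := \sum_k (x 0 k - y 0 k) ^+ 2.

Lemma sqdist_ge0 x y : 0 <= sqdist x y.
Proof. by apply: sumr_ge0 => k _; exact: sqr_ge0. Qed.

Lemma sqdistC x y : sqdist x y = sqdist y x.
Proof. by apply: eq_bigr => k _; rewrite -sqrrN opprB. Qed.

Lemma sqdist_le0 x y : sqdist x y <= 0 -> x = y.
Proof.
move=> xy; apply/rowP => k; apply/eqP; rewrite -subr_eq0 -sqrf_eq0.
have /eqP : sqdist x y = 0 by apply/eqP; rewrite eq_le xy sqdist_ge0.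
by rewrite psumr_eq0 => [/allP/(_ k (mem_index_enum _))//|i _]; exact: sqr_ge0.
Qed.

Lemma sqdist_norm x y (t : R) : 0 <= t -> sqdist x y <= t ^+ 2 -> `|x - y| <= t.
Proof.
move=> t0 xy; rewrite [leLHS]/Num.Def.normr/= mx_normrE; apply/bigmax_leP; split=> //=.
move=> [i k] _ /=; rewrite ord1 !mxE -(ler_pXn2r (n := 2)) ?nnegrE//.
rewrite real_normK ?num_real// (le_trans _ xy)// /sqdist (bigD1 k)//= lerDl.
by apply: sumr_ge0 => j _; exact: sqr_ge0.
Qed.

Lemma sqdistE x y : sqdist x y = tangent_gap y 0 x.
Proof. by apply: eq_bigr => k _; rewrite mxE mulr0 addr0. Qed.

Lemma continuous_sqdist y : continuous (sqdist ^~ y).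
Proof.
rewrite (_ : sqdist ^~ y = tangent_gap y 0); last first.
  by apply/funext => x; exact: sqdistE.
by move=> x; exact/differentiable_continuous/differentiable_tangent_gap.
Qed.

(** The touching ball of centre (y + z) / 2 lies inside the ball of centre y
    through z, and meets its sphere at z only. *)
Lemma tangent_gap_sqdist z y x :
  tangent_gap z (z - y) x = (sqdist x z + (sqdist x y - sqdist z y)) / 2.
Proof.
rewrite /tangent_gap /sqdist -sumrB -big_split/= mulr_suml.
by apply: eq_bigr => k _; rewrite !mxE; field.
Qed.

(** The closest point z is taken on the compact part Z of the contact set in a
    ball of radius r around x0.  Starting from y at distance less than r / 3
    from x0 keeps z in the interior of that ball. *)
Lemma strong_maximum_principle (U : set 'rV[R]_n) A b u (m : R) x0 :
  open U -> (forall x, U x -> posdef (A x)) ->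
  (forall x, U x -> mx_continuous_at x A) ->
  (forall x, U x -> mx_continuous_at x b) ->
  (forall x, U x -> twice_differentiable u x) ->
  (forall x, U x -> 0 <= elliptic_op A b u x) ->
  (forall x, U x -> u x <= m) -> U x0 -> u x0 = m -> \near x0, u x0 = m.
Proof.
move=> oU pA cA cb uD Lu um Ux0 ux0.
have nU x : U x -> nbhs x U by move=> Ux; exact: open_nbhs_nbhs.
have cu x : U x -> {for x, continuous u}.
  by move=> /uD[du _]; exact/differentiable_continuous/(nbhs_singleton du).
have [r r0 rU] := near_closed_ball (nU _ Ux0).
pose Z : set 'rV[R]_n := [set x | `|x - x0| <= r /\ u x = m].
have cK := @compact_closed_ball_norm x0 r.
have cZ : compact Z.
  apply: (subclosed_compact _ cK) => [x clZ|x []//].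
  have Kx : `|x - x0| <= r.
    apply: (@closed_preimage_cst_le (fun x => `|x - x0|) r
      (@continuous_dist x0) x).
    by apply: closureS clZ => y [].
  split=> //; apply/eqP; rewrite eq_le (um x (rU x Kx)) /= leNgt; apply/negP => uxm.
  have : \forall y \near x, u y < m by have /cvgr_lt := cu x (rU x Kx); apply.
  by move=> /clZ[y [[_ ->]]]; rewrite ltxx.
have Zx0 : Z x0 by split=> //; rewrite subrr normr0 ltW.
have r3 : 0 < r / 3 by rewrite divr_gt0.
have : \forall y \near x0, sqdist y x0 < (r / 3) ^+ 2.
  have /cvgr_lt := @continuous_sqdist x0 x0; apply.
  by rewrite sqdistE tangent_gap_center exprn_gt0.
apply: filterS => y /ltW yx0.
have ny : `|y - x0| <= r / 3 by apply: sqdist_norm yx0; exact: ltW.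
have [z] : exists2 z, z \in Z & forall x, x \in Z -> sqdist z y <= sqdist x y.
  apply: EVT_min_rV => //; first by exists x0.
  exact/continuous_subspaceT/continuous_sqdist.
rewrite inE => -[Kz uz] zmin; apply/eqP/negPn/negP => uym.
have nz : `|z - y| <= r / 3.
  apply: sqdist_norm; first exact: ltW.
  by apply: le_trans yx0; rewrite [leRHS]sqdistC zmin// inE.
have zx0 : `|z - x0| < r.
  rewrite -(subrK y z) -addrA (le_lt_trans (ler_normD _ _))//.
  by move: ny nz r0; lra.
have nK : \forall x \near z, `|x - x0| <= r.
  have : \forall x \near z, `|x - x0| < r.
    by have /cvgr_lt := @continuous_dist x0 z; apply.
  by apply: filterS => x /ltW.
have Uz : U z by apply: rU; exact: ltW.
suff : u z < m by rewrite uz ltxx.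
apply: (@no_interior_touching A b u z (z - y)).
- by rewrite subr_eq0; apply: contraNneq uym => <-; apply/eqP.
- exact: cA.
- exact: cb.
- apply: filterS nK => x /rU Ux.
  by split; [exact: pA | exact: uD | exact: Lu | exact: um].
- apply: filterS nK => x Kx xz; rewrite tangent_gap_sqdist => gx.
  rewrite lt_neqAle (um x (rU x Kx)) andbT.
  apply: contraNneq xz => uxm; apply/eqP/sqdist_le0.
  have : sqdist z y <= sqdist x y by apply: zmin; rewrite inE.
  by move: gx; lra.
Qed.

End StrongMaximumPrinciple.

(** * The Laplacian on functions of the second factor *)

Section Coefficients.
Context {R : realType}.

Lemma continuous_at_near_eq (T U : topologicalType) (f g : T -> U) (x : T) :
  (\near x, f x = g x) -> continuous_at x f -> continuous_at x g.
Proof.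
move=> fg; rewrite /continuous_at -(nbhs_singleton fg) => cf.
by apply: cvg_trans cf; exact: near_eq_cvg.
Qed.

Lemma continuous_at_det (T : topologicalType) n (A : T -> 'M[R]_n) (x : T) :
  mx_continuous_at x A -> continuous_at x (fun y => \det (A y)).
Proof.
move=> cA; apply: continuous_at_sum => s.
apply: continuous_at_mul; first exact: continuous_at_cst.
by apply: continuous_at_prod => i; exact: cA.
Qed.

(** Cramer's rule gives [invmx] only at invertible matrices, hence the
    neighbourhood. *)
Lemma mx_continuous_at_invmx (T : topologicalType) n (A : T -> 'M[R]_n) (x : T) :
  mx_continuous_at x A -> (\forall y \near x, A y \in unitmx) ->
  mx_continuous_at x (fun y => invmx (A y)).
Proof.
move=> cA uA i j.
apply: (@continuous_at_near_eq _ _ (fun y => (\det (A y))^-1 * \adj (A y) i j)).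
  by apply: filterS uA => y uy; rewrite /invmx uy !mxE.
apply: continuous_at_mul.
  apply: cvgV; last exact: continuous_at_det.
  by have := nbhs_singleton uA; rewrite unitmxE unitfE.
rewrite (_ : (fun y => _) = (fun y =>
    (-1) ^+ (j + i) * \det (row' j (col' i (A y))))); last first.
  by apply/funext => y; rewrite mxE.
apply: continuous_at_mul; first exact: continuous_at_cst.
apply: continuous_at_det => k l.
rewrite (_ : (fun y => _) = (fun y => A y (lift j k) (lift i l))).
  exact: cA.
by apply/funext => y; rewrite !mxE.
Qed.

Lemma continuous_at_christoffel n (U : set 'rV[R]_n) (g : 'rV[R]_n -> 'M[R]_n)
    k i j x :
  open U -> U x -> (forall a b, smooth_on U (fun y => g y a b)) ->
  (forall y, U y -> g y \in unitmx) -> continuous_at x (christoffel g k i j).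
Proof.
move=> oU Ux sg ug; rewrite /christoffel; apply: continuous_at_mul.
  exact: continuous_at_cst.
have cp a b l : continuous_at x (partial l (fun y => g y a b)).
  exact/differentiable_continuous/(sg a b [:: l] x Ux).
apply: continuous_at_sum => l; apply: continuous_at_mul.
  apply: mx_continuous_at_invmx => [a b|].
    exact/differentiable_continuous/(sg a b [::] x Ux).
  by have := open_nbhs_nbhs (conj oU Ux); apply: filterS.
apply: continuous_at_add; last exact: continuous_at_opp.
exact: continuous_at_add.
Qed.

Lemma continuous_row_mx n1 n2 (a : 'rV[R]_n1) :
  continuous (fun y : 'rV[R]_n2 => row_mx a y).
Proof.
move=> y B [P PB sB]; exists (fun i k => P i (rshift n1 k)).
  by move=> i k; have := PB i (rshift n1 k); rewrite row_mxEr.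
move=> w wP; apply: sB => i k; rewrite ord1.
case: (split_ordP k) => l ->; rewrite ?row_mxEr ?row_mxEl; last exact: wP.
by have := PB 0 (lshift n2 l); rewrite row_mxEl => /nbhs_singleton.
Qed.

(** Coefficients of the second and first order parts of the Laplacian of the
    metric g, acting on functions of the last n2 coordinates along the slice
    where the first n1 coordinates are a. *)
Definition slice_principal {n1 n2} (g : 'rV[R]_(n1 + n2) -> 'M[R]_(n1 + n2))
    (a : 'rV[R]_n1) (y : 'rV[R]_n2) : 'M[R]_n2 :=
  drsubmx (invmx (g (row_mx a y))).

Definition slice_drift {n1 n2} (g : 'rV[R]_(n1 + n2) -> 'M[R]_(n1 + n2))
    (a : 'rV[R]_n1) (y : 'rV[R]_n2) : 'rV[R]_n2 :=
  \row_k - \sum_i \sum_j invmx (g (row_mx a y)) i j *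
    christoffel g (rshift n1 k) j i (row_mx a y).

(** Partial derivatives in the first n1 directions vanish, so only the lower
    right block of the second derivatives survives, whereas every Christoffel
    symbol with upper index in the second factor contributes to the drift. *)
Lemma laplacian_slice n1 n2 (g : 'rV[R]_(n1 + n2) -> 'M[R]_(n1 + n2))
    (a : 'rV[R]_n1) (y : 'rV[R]_n2) (u : 'rV[R]_n2 -> R) :
  \tr (invmx (g (row_mx a y)) *m hessian g (u \o rsubmx) (row_mx a y)) =
  elliptic_op (slice_principal g a) (slice_drift g a) u y.
Proof.
set x := row_mx a y; set B := invmx (g x).
have pE (v : 'rV[R]_n2 -> R) k : partial (rshift n1 k) (v \o rsubmx) x = partial k v y.
  by rewrite partial_rsubmx (unsplitK (inr k)) /= row_mxKr.
have p0 (v : 'rV[R]_n2 -> R) k : partial (lshift n2 k) (v \o rsubmx) = cst 0.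
  by rewrite partial_rsubmx (unsplitK (inl k)).
have -> : hessian g (u \o rsubmx) x = block_mx 0 0 0 (coord_hessian u y) -
    \matrix_(i, j) \sum_(k < n2) christoffel g (rshift n1 k) i j x * partial k u y.
  apply/matrixP => i j; rewrite [LHS]mxE [RHS]mxE; congr (_ + _); last first.
    rewrite [RHS]mxE mxE; congr (- _).
    rewrite big_split_ord/= big1 ?add0r => [|k _]; last by rewrite p0 mulr0.
    by apply: eq_bigr => k _; rewrite pE.
  case: (split_ordP j) => l ->.
    rewrite p0 /partial derive_cst.
    by case: (split_ordP i) => k ->; rewrite ?block_mxEul ?block_mxEdl mxE.
  have -> : partial (rshift n1 l) (u \o rsubmx) = partial l u \o rsubmx.
    by rewrite partial_rsubmx (unsplitK (inr l)).
  case: (split_ordP i) => k ->; first by rewrite p0 block_mxEur mxE.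
  by rewrite pE block_mxEdr mxE.
rewrite mulmxBr linearB /=; congr (_ + _).
  rewrite -{1}(submxK B) mulmx_block mxtrace_block !mulmx0 !addr0 mxtrace0 !add0r.
  by [].
(* Exchange the sums over the matrix indices and over the derivatives. *)
under [RHS]eq_bigr do rewrite mxE mulNr mulr_suml.
rewrite sumrN /mxtrace; congr (- _); rewrite [RHS]exchange_big.
apply: eq_bigr => i _; rewrite mxE.
under [RHS]eq_bigr do rewrite mulr_suml.
rewrite [RHS]exchange_big; apply: eq_bigr => j _.
by rewrite mxE mulr_sumr; apply: eq_bigr => k _; rewrite mulrA.
Qed.

Lemma continuous_at_comp (T U : topologicalType) (f : T -> U) (h : U -> R) x :
  continuous_at x f -> continuous_at (f x) h -> continuous_at x (h \o f).
Proof. by move=> cf ch; exact: (continuous_comp cf ch). Qed.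

Lemma slice_coefficients n1 n2 (U : set 'rV[R]_(n1 + n2))
    (g : 'rV[R]_(n1 + n2) -> 'M[R]_(n1 + n2)) (a : 'rV[R]_n1) (y : 'rV[R]_n2) :
  open U -> U (row_mx a y) -> (forall x, U x -> posdef (g x)) ->
  (forall k l, smooth_on U (fun x => g x k l)) ->
  [/\ posdef (slice_principal g a y),
      mx_continuous_at y (slice_principal g a) &
      mx_continuous_at y (slice_drift g a)].
Proof.
move=> oU Ux pg sg.
have ug x : U x -> g x \in unitmx by move=> /pg; exact: posdef_unitmx.
have cI : mx_continuous_at (row_mx a y) (fun x => invmx (g x)).
  apply: mx_continuous_at_invmx => [k l|].
    exact/differentiable_continuous/(sg k l [::] _ Ux).
  by have := open_nbhs_nbhs (conj oU Ux); apply: filterS.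
have cR := @continuous_row_mx n1 n2 a y.
split; first exact/posdef_drsubmx/posdef_invmx/pg.
- move=> k l; rewrite (_ : (fun z => _) =
    (fun x => invmx (g x) (rshift n1 k) (rshift n1 l)) \o row_mx a); last first.
    by apply/funext => z; rewrite !mxE.
  exact: continuous_at_comp.
- move=> k l; rewrite (_ : (fun z => _) = (fun x => - \sum_i \sum_j
    invmx (g x) i j * christoffel g (rshift n1 l) j i x) \o row_mx a); last first.
    by apply/funext => z; rewrite !mxE.
  apply: continuous_at_comp => //.
  apply: continuous_at_opp; apply: continuous_at_sum => i.
  apply: continuous_at_sum => j; apply: continuous_at_mul; first exact: cI.
  exact: (@continuous_at_christoffel _ U).
Qed.

Lemma differentiable_ln (V : normedModType R) (F : V -> R) x v :
  0 < F x -> differentiable F x ->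
  differentiable (@ln R \o F) x /\ 'D_v (@ln R \o F) x = (F x)^-1 * 'D_v F x.
Proof.
move=> F0 dF; have [dl lE] := is_derive1_ln F0.
have dln : differentiable (@ln R) (F x) by exact/derivable1_diffP.
split; first exact: differentiable_comp.
rewrite deriveE; last exact: differentiable_comp.
rewrite diff_comp//= -(deriveE v dF) -[X in 'd _ _ X]mulr1 -[_ * 1]/(_ *: 1) linearZ.
by rewrite -deriveE// lE mulrC.
Qed.

Lemma twice_differentiable_ln n (U : set 'rV[R]_n) (F : 'rV[R]_n -> R) x :
  open U -> U x -> (forall y, U y -> 0 < F y) -> smooth_on U F ->
  twice_differentiable (@ln R \o F) x.
Proof.
move=> oU Ux F0 sF; have nU : \near x, U x by exact: open_nbhs_nbhs.
split=> [|k].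
  apply: filterS nU => y Uy.
  by have [] := differentiable_ln 0 (F0 y Uy) (sF [::] y Uy).
apply: (@near_eq_differentiable _ _ _ ((fun y => (F y)^-1) * partial k F)).
  apply: filterS nU => y Uy.
  by have [_] := differentiable_ln (delta_mx 0 k) (F0 y Uy) (sF [::] y Uy).
apply: differentiableM; last exact: (sF [:: k]).
apply: differentiableV; [exact: (sF [::]) | exact/lt0r_neq0/F0].
Qed.

End Coefficients.

(** * The maximum set on the second factor *)

Section Manifolds.
Context {R : realType}.

Lemma smooth_fun_continuous n (M : manifold R n) (f : M -> R) :
  smooth_fun f -> continuous f.
Proof.
move=> sf q; have [i iq] := mcover q.
have cq := cmap_cod iq.
have cf : continuous_at (cmap (mchart i) q) (f \o cinv (mchart i)).
  exact/differentiable_continuous/(sf i [::] _ cq).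
apply: (@continuous_at_near_eq _ _ ((f \o cinv (mchart i)) \o cmap (mchart i))).
  have : nbhs q (cdom (mchart i)).
    by apply: open_nbhs_nbhs; split=> //; exact: cdom_open.
  by apply: filterS => p ip; rewrite /= cmapK.
by apply: continuous_at_comp => //; exact: cmap_continuous.
Qed.

(** The logarithm is increasing, so f2 and l have the same maximum points; the
    strong maximum principle applies to l in a chart around such a point, along
    the slice above p. *)
Lemma harmonic_log_max_open n1 n2 (M1 : manifold R n1) (M2 : manifold R n2)
    (g : tensor2 (prod_manifold M1 M2)) (f2 : M2 -> R) (m : R) (p : M1) :
  riemannian_metric g -> smooth_fun f2 -> (forall q, 0 < f2 q) ->
  harmonic_fun g (fun x : prod_manifold M1 M2 => ln (f2 x.2)) ->
  (forall q, f2 q <= m) -> open [set q | f2 q = m].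
Proof.
move=> rg sf f0 hl fm.
rewrite openE => q /= fq.
have m0 : 0 < m by rewrite -fq.
have [i ip] := mcover p; set a := cmap (mchart i) p.
have ca : ccod (mchart i) a := cmap_cod ip.
have [j jq] := mcover q; set y := cmap (mchart j) q.
have cy : ccod (mchart j) y := cmap_cod jq.
pose k : mindex (prod_manifold M1 M2) := (i, j).
have oU := @ccod_open _ _ _ (mchart j).
have kz z : ccod (mchart j) z -> ccod (mchart k) (row_mx a z).
  by move=> jz; split; rewrite ?row_mxKl ?row_mxKr.
have pg x : ccod (mchart k) x -> posdef (g k x).
  move=> kx; split; first exact: (Defs.metric_sym rg kx).
  by move=> v; exact: (metric_posdef rg kx).
have coef z : ccod (mchart j) z ->
    [/\ posdef (slice_principal (g k) a z),
        mx_continuous_at z (slice_principal (g k) a) &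
        mx_continuous_at z (slice_drift (g k) a)].
  move=> /kz kaz; apply: (slice_coefficients (@ccod_open _ _ _ (mchart k))) => //.
  by move=> r s; exact: (metric_smooth rg).
pose F := f2 \o cinv (mchart j).
have : \forall z \near y, (@ln R \o F) z = ln m.
  apply: (@strong_maximum_principle R n2 (ccod (mchart j))
    (slice_principal (g k) a) (slice_drift (g k) a)) => //.
  - by move=> z /coef[].
  - by move=> z /coef[].
  - by move=> z /coef[].
  - move=> z jz; apply: (twice_differentiable_ln oU) => // w _; exact: f0.
  - move=> z jz; rewrite -laplacian_slice.
    by have := hl k (row_mx a z) (kz z jz); rewrite /laplacian => ->.
  - by move=> z jz; rewrite /= ler_ln ?posrE ?f0 ?m0 ?fm.
  - by rewrite /F /y /= cmapK// fq.
move=> /(cmap_continuous jq); have : nbhs q (cdom (mchart j)).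
  by apply: open_nbhs_nbhs; split=> //; exact: cdom_open.
apply: filterS2 => r jr /=; rewrite /F /= cmapK// => /ln_inj; apply.
  by rewrite posrE f0.
by rewrite posrE.
Qed.

Lemma doubly_warped_metric_cst n1 n2 (M1 : manifold R n1) (M2 : manifold R n2)
    (g1 : tensor2 M1) (g2 : tensor2 M2) (f1 : M1 -> R) (f2 : M2 -> R) (c : R) :
  (forall q, f2 q = c) ->
  tensor2_eq (doubly_warped_metric g1 g2 f1 f2)
    (warped_metric (fun i x => c ^+ 2 *: g1 i x) g2 f1).
Proof.
move=> f2c i x ix; rewrite /doubly_warped_metric /warped_metric f2c.
by congr (_ + _); rewrite /pullback_fst /pullback2 -scalemxAr -scalemxAl.
Qed.

End Manifolds.

Theorem theorem3p2 (R : realType) (n1 n2 : nat)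
    (M1 : manifold R n1) (M2 : manifold R n2)
    (M1_nonempty : [set: M1] !=set0)
    (M2_connected : connected [set: M2])
    (g1 : tensor2 M1) (g2 : tensor2 M2)
    (g1_riemannian : riemannian_metric g1)
    (g2_riemannian : riemannian_metric g2)
    (f1 : M1 -> R) (f2 : M2 -> R)
    (f1_smooth : smooth_fun f1) (f2_smooth : smooth_fun f2)
    (f1_gt0 : forall p, 0 < f1 p) (f2_gt0 : forall q, 0 < f2 q)
    (M2_compact : compact [set: M2])
    (l_harmonic : harmonic_fun (doubly_warped_metric g1 g2 f1 f2)
                    (fun p : prod_manifold M1 M2 => ln (f2 p.2))) :
  is_warped_product g1 g2 f1 f2.
Proof.
suff [c c0 f2c] : exists2 c, 0 < c & forall q, f2 q = c.
  by exists c; split => //; exact: doubly_warped_metric_cst.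
have [M20|M2n] := pselect ([set: M2] !=set0); last first.
  by exists 1 => // q; exfalso; apply: M2n; exists q.
have cf2 := smooth_fun_continuous f2_smooth.
have [q0 _ f2max] := compact_EVT_max M20 M2_compact (continuous_subspaceT cf2).
have f2le q : f2 q <= f2 q0 by apply: f2max; rewrite inE.
exists (f2 q0) => // q.
have [p _] := M1_nonempty.
have oZ : open [set q | f2 q = f2 q0].
  apply: (harmonic_log_max_open p _ f2_smooth f2_gt0 l_harmonic f2le).
  exact: doubly_warped_riemannian.
have cZ : closed [set q | f2 q = f2 q0].
  apply: (@preimage_closed _ _ f2 [set y | y = f2 q0]); last exact: closed_eq.
  by move=> x _; exact: cf2.
have ZT : [set q | f2 q = f2 q0] = [set: M2].
  apply: M2_connected; first by exists q0.
  - by exists [set q | f2 q = f2 q0]; rewrite ?setTI.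
  - by exists [set q | f2 q = f2 q0]; rewrite ?setTI.
by have : [set: M2] q by []; rewrite -ZT.
Qed.
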